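(* (SCD of one-to-many channels.) A $1\times K$ Gaussian channel with SNRs $\Gamma_1\ge\Gamma_2\ge\cdots\ge\Gamma_K$, $\Gamma_1>1$, can be decomposed into a set of $N_1\in\mathbb{N}\setminus\{0\}$ successive sub-channels, where user (receiver) $i$ has access to sub-channels $N_1-N_i+1,\dots,N_1$, with $\gamma^{N_1}=\Gamma_1$ ($\gamma>1$) and $N_i=\left\lfloor\frac{\log(\Gamma_i)}{\log(\gamma)}\right\rfloor$ for $i=2,\dots,K$. The achievable rate of each sub-channel is $\hat{C}(\gamma/(1+\mu))$, where $\mu=0$ if $K=1$ and $\mu=1$ otherwise. Explicitly: for every $0\le R<\hat{C}(\gamma/(1+\mu))$ there is a sequence (in the block length $n$) of codes in which the transmitter sends $x^{(n)}=\sum_{\ell=1}^{N_1}x_\ell^{(n)}$, where $x_\ell^{(n)}$ has power $p_\ell=\gamma^\ell-\gamma^{\ell-1}$ and encodes an independent message $m_\ell$ of rate at least $R$, such that the power constraint is satisfied and every receiver $i\in\{1,\dots,K\}$ can decode, successively for $\ell=N_1,N_1-1,\dots,N_1-N_i+1$, the message $m_\ell$ with error probability tending to $0$ as $n\to\infty$.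
   Context: Notation: $C(x)=\frac12\log_2(1+x)$ and $\hat{C}(x)=\max\{0,C(x-1)\}=\max\{0,\frac12\log_2 x\}$; a range $a,\dots,b$ with $a>b$ is empty. $1\times K$ Gaussian (one-to-many) channel with SNRs $\Gamma_1\ge\cdots\ge\Gamma_K$: one real input $X$ with average power constraint $\Gamma=\Gamma_1$, and $K$ outputs $Y_i=X+Z_i$, $i=1,\dots,K$, where $Z_i\sim\mathcal{N}(0,\sigma_i^2)$ is i.i.d. over time, $\sigma_1^2=1$ and $\Gamma_i=\Gamma/\sigma_i^2$. Successive sub-channels: sub-channel $\ell\in\{1,\dots,N_1\}$ corresponds to the signal layer $x_\ell^{(n)}$ with power $p_\ell=\gamma^\ell-\gamma^{\ell-1}$. A receiver decodes sub-channels successively in decreasing order of $\ell$; when decoding $x_\ell^{(n)}$ it has subtracted the already decoded signals on sub-channels $\ell+1,\dots,N_1$ and treats the signals on sub-channels $1,\dots,\ell-1$ as noise. *)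

(* Defs.v *)
From HB Require Import structures.
From mathcomp Require Import all_boot all_order all_algebra.
From mathcomp Require Import all_classical all_reals all_analysis.
Import Order.TTheory GRing.Theory Num.Theory.
Import numFieldNormedType.Exports.

Set Implicit Arguments.
Unset Strict Implicit.
Unset Printing Implicit Defensive.

Local Open Scope classical_set_scope.
Local Open Scope ring_scope.

Definition log2 {R : realType} (x : R) : R := ln x / ln 2.

Definition capacity {R : realType} (x : R) : R := 2^-1 * log2 (1 + x).

Definition capacity_hat {R : realType} (x : R) : R :=
  Num.max 0 (capacity (x - 1)).

Definition mutually_independent {R : realType} {d : measure_display}
    {Omega : measurableType d} {P : probability Omega R}
    (X : nat -> {RV P >-> R}) : Prop :=
  forall (J : seq nat) (A : nat -> set R), uniq J ->
    (forall t, measurable (A t)) ->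
    P (\bigcap_(t in [set` J]) (X t @^-1` A t)) =
    (\prod_(t <- J) P (X t @^-1` A t))%E.

Definition iid_normal {R : realType} {d : measure_display}
    {Omega : measurableType d} {P : probability Omega R}
    (s : R) (X : nat -> {RV P >-> R}) : Prop :=
  mutually_independent X /\
  forall t (A : set R), measurable A ->
    distribution P (X t) A = normal_prob 0 s A.

Notation signal n R := (n.-tuple (measurableTypeR R)).

Definition add_signal {R : realType} {n : nat} (x y : signal n R) :
  signal n R := [tuple tnth x t + tnth y t | t < n].

Definition sub_signal {R : realType} {n : nat} (x y : signal n R) :
  signal n R := [tuple tnth x t - tnth y t | t < n].

(* Expected power per channel use of the signal x carrying a message that is
   uniformly distributed over M. *)
Definition average_power {R : realType} {n : nat} {M : finType}
    (x : M -> signal n R) : R :=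
  (\sum_(m : M) \sum_(t < n) tnth (x m) t ^+ 2) / (#|M|%:R * n%:R).

(* Density of the output y of a memoryless channel with additive Gaussian noise
   of variance v when the input is x. *)
Definition gaussian_likelihood {R : realType} {n : nat} (v : R)
    (x y : signal n R) : R :=
  \prod_(t < n) normal_pdf (tnth x t) (Num.sqrt v) (tnth y t).

(* Sub-channels are numbered from 0: l : 'I_N stands for the sub-channel usually
   numbered l + 1. *)
Definition layer_power {R : realType} (gamma : R) (l : nat) : R :=
  gamma ^+ l.+1 - gamma ^+ l.

(* A block code of length n for N sub-channels and K receivers. The decoder
   dec i l of receiver i maps the signal that is left once the sub-channels
   above l have been subtracted to an estimate of message l alone. *)
Record layered_code (R : realType) (n N K : nat) := LayeredCode {
  msize : 'I_N -> nat;
  msize_gt0 : forall l, (0 < msize l)%N;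
  enc : forall l, 'I_(msize l) -> signal n R;
  dec : 'I_K -> forall l, signal n R -> 'I_(msize l);
  measurable_dec : forall i l (m : 'I_(msize l)),
    measurable (dec i l @^-1` [set m])
}.

Section layered_code.
Context {R : realType} {n N K : nat} (c : layered_code R n N K).

Definition messages : finType := {dffun forall l : 'I_N, 'I_(msize c l)}.

Definition code_rate (l : 'I_N) : R := log2 (msize c l)%:R / n%:R.

Definition transmitted (m : messages) : signal n R :=
  [tuple \sum_(l < N) tnth (enc (m l)) t | t < n].

(* Starting from y, decode and subtract the sub-channels N - 1, ..., l + 1, in
   this order. *)
Definition residual (i : 'I_K) (l : 'I_N) (y : signal n R) : signal n R :=
  foldl (fun r k => sub_signal r (enc (dec c i k r))) y
    (rev [seq k : 'I_N <- enum 'I_N | (l < k)%N]).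

Definition successive_estimate (i : 'I_K) (l : 'I_N) (y : signal n R) :
  'I_(msize c l) := dec c i l (residual i l y).

(* Decoder i l is the point-to-point maximum-likelihood decoder for codebook l
   when the sub-channels k < l, of powers p k, are considered as additional white
   Gaussian noise. *)
Definition treats_lower_as_noise (s : R) (p : nat -> R) (i : 'I_K) (l : 'I_N) :
    Prop :=
  let v := s ^+ 2 + \sum_(k < l) p k in
  forall (y : signal n R) (m : 'I_(msize c l)),
    gaussian_likelihood v (enc m) y <=
    gaussian_likelihood v (enc (dec c i l y)) y.

(* Probability that receiver i decodes message l wrongly, when the messages are
   independent, uniformly distributed and independent of the noise Z. *)
Definition error_probability {d : measure_display} {Omega : measurableType d}
    {P : probability Omega R} (Z : nat -> {RV P >-> R})
    (i : 'I_K) (l : 'I_N) : R :=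
  (\sum_(m : messages)
     fine (P [set w | successive_estimate i l
                (add_signal (transmitted m) [tuple Z t w | t < n]) != m l]))
  / #|messages|%:R.

End layered_code.

(* Number of sub-channels a receiver has access to; it is not positive if the
   receiver has no sub-channel. *)
Definition num_subchannels {R : realType} {K : nat} (gamma : R) (N1 : nat)
    (Gam : 'I_K -> R) (i : 'I_K) : int :=
  if (i : nat) == 0%N then N1%:Z else Num.floor (ln (Gam i) / ln gamma).

Definition has_access {R : realType} {K : nat} (gamma : R) (N1 : nat)
    (Gam : 'I_K -> R) (i : 'I_K) (l : 'I_N1) : bool :=
  N1%:Z - num_subchannels gamma N1 Gam i + 1 <= l.+1%:Z.

(* Main.v *)
(** Random coding, with the sub-channels treated one at a time from the bottom.
The codewords of a sub-channel of power [p] are independent Gaussian vectors of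
power [q < p] per letter, sampled from the noise of the first receiver, which is
an i.i.d. normal sequence. For a FIXED interference-plus-noise vector [w] with
[|w|^2 <= n N], Chernoff bounds show that, up to exponentially small
probability, [|x + w|^2 - |w|^2] lies between [n c] and [n p] (where
[c < q < p]), and that an independent codeword [x'] beats [x] in the
nearest-neighbour test with probability at most [(1 + c / N)^(-n/2)]. As these
bounds are uniform in [w], the lower sub-channels may be arbitrary vectors: what
is passed on to the next sub-channel is only that [|x + w|^2 <= n (N + p)].
Averaging over codebooks with Tonelli's theorem produces a good codebook for each
sub-channel in turn.

The exact power constraints come from three modifications which do not disturb
nearest-neighbour decoding: codewords that are too long are replaced by 0, every
codeword is accompanied by its opposite (so that codebooks have mean 0 and powers
add up), and one more pair of codewords, which is far away from all the others
and rarely sent, carries the missing power. *)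

Require Import Defs.
From HB Require Import structures.
From mathcomp Require Import all_boot all_order all_algebra.
From mathcomp Require Import all_classical all_reals all_analysis.
From mathcomp Require Import measurable_realfun perm zify ring lra.
Import Order.TTheory GRing.Theory Num.Theory.
Import numFieldNormedType.Exports.

Set Implicit Arguments.
Unset Strict Implicit.
Unset Printing Implicit Defensive.

Local Open Scope classical_set_scope.
Local Open Scope ring_scope.

Import HBNNSimple.

(** * Gaussian sequences *)

(** Layers are counted from 0, so the layers below [l] have total power gamma^l - 1. The decoders
    are prescribed as maximum likelihood against white Gaussian noise, but the true interference of
    a layer is noise plus words of fixed codebooks, which is not white Gaussian. So only its norm is
    used, never its law. With |w|^2 <= n N and c just below p_l, about e^(n rho) rivals are harmless
    as soon as e^(2 rho) < 1 + c / N. Access of receiver i to layer l gives sigma_i^2 <= gamma^l,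
    hence N, about gamma^l - 1 + sigma_i^2, is below 2 gamma^l: this is the origin of mu = 1. A
    single receiver has sigma^2 = 1 and N about gamma^l, whence mu = 0. Codebooks are chosen from
    the bottom although decoding runs from the top, because the interference of a layer involves
    only the layers below it. One codebook has to serve all receivers, so the failure probabilities
    are summed over receivers and messages before it is chosen. For a receiver without access to a
    layer, it is still required that the layer add no more than its share of power, but not that it
    be decodable. *)

(** Approximation by simple functions. Allowing both a map and a density covers three uses at once:
    a change of variables ([h = 1]), a density ([phi] the identity) and the weighted law B |-> E(h;
    X t in B). *)
Lemma ge0_integral_density (R : realType) (d1 d2 : measure_display)
    (X : measurableType d1) (Y : measurableType d2) (phi : X -> Y)
    (mphi : measurable_fun setT phi) (mu : {measure set X -> \bar R})
    (m : {measure set Y -> \bar R}) (h : X -> R) (f : Y -> R) :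
  (forall x, 0 <= h x) -> measurable_fun setT h ->
  (forall y, 0 <= f y) -> measurable_fun setT f ->
  (forall B, measurable B -> m B = \int[mu]_(x in phi @^-1` B) (h x)%:E)%E ->
  (\int[m]_y (f y)%:E = \int[mu]_x (f (phi x) * h x)%:E)%E.
Proof.
move=> h0 mh f0 mf mE.
have mEf : measurable_fun setT (EFin \o f) by exact/measurable_EFinP.
pose f_ := nnsfun_approx measurableT mEf.
have mfphi n : measurable_fun setT (f_ n \o phi).
  by apply: measurableT_comp.
transitivity (limn (fun n => \int[m]_y (f_ n y)%:E))%E.
  rewrite -monotone_convergence//.
  - apply: eq_integral => y _; apply/esym/cvg_lim => //.
    by apply: cvg_nnsfun_approx => // *; rewrite lee_fin.
  - by move=> n; exact/measurable_EFinP.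
  - by move=> n y _; rewrite lee_fin.
  - by move=> y _ a b ab; rewrite lee_fin; exact/lefP/nd_nnsfun_approx.
rewrite [X in limn X](_ : _ =
    (fun n => \int[mu]_x (f_ n (phi x) * h x)%:E)%E).
  rewrite -monotone_convergence//.
  - apply: eq_integral => x _; apply/cvg_lim => //.
    have fh : ((f_ n (phi x))%:E @[n --> \oo] --> (f (phi x))%:E)%E.
      apply: (@cvg_nnsfun_approx _ _ _ setT measurableT _ mEf) => // *.
      by rewrite lee_fin.
    rewrite EFinM.
    under eq_fun do rewrite EFinM.
    by apply: cvgeZr => //.
  - move=> n; apply/measurable_EFinP/measurable_funM => //; exact: mfphi.
  - by move=> n x _; rewrite lee_fin mulr_ge0.
  - move=> x _ a b ab; rewrite lee_fin ler_wpM2r//.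
    exact/lefP/nd_nnsfun_approx.
apply/funext => n.
have mk k : measurable (phi @^-1` (f_ n @^-1` [set k])).
  by rewrite -(setTI (_ @^-1` _)); exact: mphi.
transitivity (\sum_(k \in range (f_ n)) \int[mu]_x
    (k * (\1_(f_ n @^-1` [set k]) (phi x) * h x))%:E)%E.
  under eq_integral do rewrite fimfunE -fsumEFin//.
  rewrite ge0_integral_fsum//; last 2 first.
  - by move=> y; exact/measurable_EFinP/measurable_funM.
  - by move=> y x _; rewrite nnfun_muleindic_ge0.
  apply: eq_fsbigr => r; rewrite inE => -[y _ ry].
  have r0 : 0 <= r by rewrite -ry.
  rewrite integralZl_indic_nnsfun// integral_indic//= setIT.
  under [RHS]eq_integral do rewrite EFinM.
  rewrite ge0_integralZl_EFin//; last 2 first.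
  - by move=> x _; rewrite lee_fin mulr_ge0.
  - apply/measurable_EFinP/measurable_funM => //.
    apply: (measurableT_comp _ mphi) => //.
  rewrite mE// integral_mkcond; congr (_ * _)%E.
  apply: eq_integral => x _; rewrite patchE indicE.
  have -> : (x \in phi @^-1` (f_ n @^-1` [set r])) =
    (phi x \in f_ n @^-1` [set r]) by apply/idP/idP => /set_mem ?; exact/mem_set.
  by case: ifPn => _; rewrite ?mul1r ?mul0r.
rewrite -ge0_integral_fsum//.
- apply: eq_integral => x _; rewrite fsumEFin//; congr EFin.
  rewrite [in RHS]fimfunE !fsbig_finite//= mulr_suml.
  by apply: eq_bigr => r _; rewrite mulrA.
- move=> r; apply/measurable_EFinP/measurable_funM => //.
  apply: measurable_funM => //; exact: (measurableT_comp _ mphi).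
- move=> r x _; rewrite mulrA EFinM mule_ge0// ?lee_fin//.
  exact: nnfun_muleindic_ge0.
Qed.

(* The indicators are traded for arbitrary functions one index [t] at a time, by
   comparing the measure [B |-> E(h; X t \in B)] with a multiple of the law of
   [X t]. *)
Lemma independent_expectation_indic (R : realType) (d : measure_display)
    (Omega : measurableType d) (P : probability Omega R)
    (X : nat -> {RV P >-> R}) (g : nat -> R -> R) (G : nat -> R)
    (J I : seq nat) (A : nat -> set R) :
  mutually_independent X -> uniq (J ++ I) ->
  (forall t x, 0 <= g t x) -> (forall t, measurable_fun setT (g t)) ->
  (forall t, \int[P]_w (g t (X t w))%:E = (G t)%:E)%E ->
  (forall t, measurable (A t)) ->
  (\int[P]_w ((\prod_(t <- J) g t (X t w)) *
              \prod_(t <- I) \1_(A t) (X t w))%:E =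
   ((\prod_(t <- J) G t) * \prod_(t <- I) fine (P (X t @^-1` A t)))%:E)%E.
Proof.
move=> indX + g0 mg gE; elim: J I A => [|t J IH] I A /=.
  move=> uI mA; under eq_integral do rewrite big_nil mul1r.
  rewrite big_nil mul1r.
  have mXA s : measurable (X s @^-1` A s).
    by rewrite -[X in measurable X]setTI; exact: measurable_funP.
  transitivity (P (\bigcap_(t in [set` I]) (X t @^-1` A t))).
    have mI : measurable (\bigcap_(t in [set` I]) (X t @^-1` A t)).
      by apply: fin_bigcap_measurable.
    rewrite -[X in _ = P X]setIT -integral_indic//.
    apply: eq_integral => w _; congr EFin.
    have [/set_mem wI|] := boolP (w \in \bigcap_(t in [set` I]) (X t @^-1` A t)).
      rewrite indicE mem_set//= big_seq big1// => s sI.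
      by rewrite indicE mem_set//; exact: wI.
    move=> wI; rewrite indicE (negbTE wI)/=.
    have [s [sI nA]] : exists s, s \in I /\ ~ A s (X s w).
      apply: contrapT => H; move/negP: wI; apply; apply/mem_set => s /= sI.
      by apply: contrapT => nA; apply: H; exists s.
    apply/eqP; rewrite prodf_seq_eq0; apply/hasP; exists s => //=.
    by rewrite indicE memNset.
  rewrite indX// -prodEFin; apply: eq_bigr => s _.
  by rewrite fineK// fin_num_measure.
move=> /andP[tJI uJI] mA.
pose c := (\prod_(t <- J) G t) * \prod_(t <- I) fine (P (X t @^-1` A t)).
have G0 s : 0 <= G s.
  by rewrite -lee_fin -gE integral_ge0// => w _; rewrite lee_fin.
have c0 : 0 <= c.
  by rewrite mulr_ge0// prodr_ge0// => s _; rewrite fine_ge0.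
pose h w := (\prod_(t <- J) g t (X t w)) * \prod_(t <- I) \1_(A t) (X t w).
have mX s : measurable_fun setT (X s) by exact: measurable_funP.
have mh : measurable_fun setT h.
  apply: measurable_funM.
    by apply: measurable_prod => s _; exact: measurableT_comp.
  apply: measurable_prod => s _; apply: (measurableT_comp _ (mX s)).
  exact: measurable_indic.
have h0 w : 0 <= h w.
  by rewrite mulr_ge0// prodr_ge0.
rewrite (_ : (fun _ => _) = fun w => (g t (X t w) * h w)%:E); last first.
  by apply/funext => w; rewrite big_cons mulrA.
rewrite -(@ge0_integral_density _ _ _ _ _ (X t) (mX t) P
    (mscale (NngNum c0) (distribution P (X t))) h (g t))//; last first.
  move=> B mB.
  (* The induction hypothesis is used for [t :: I] with the test set [B] at [t]; since [t] is not in
     [I], the other sets are unaffected. *)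
  pose A' s := if s == t then B else A s.
  have mA' s : measurable (A' s) by rewrite /A'; case: ifP.
  have := IH (t :: I) A'.
  rewrite -cat_rcons -cats1 -catA.
  have -> : uniq (J ++ [:: t] ++ I).
    by rewrite (perm_uniq (permEl (perm_catCA _ _ _))) /= tJI.
  move=> /(_ isT mA'); rewrite /mscale/= => IHE.
  have AE s : s \in I -> A' s = A s.
    rewrite /A'; case: eqP => // -> tI.
    by move: tJI; rewrite mem_cat tI orbT.
  transitivity (c * fine (P (X t @^-1` B)))%:E.
    by rewrite EFinM fineK// fin_num_measure//; rewrite -[X in measurable X]setTI; exact: mX.
  rewrite integral_mkcond.
  transitivity (((\prod_(t0 <- J) G t0) *
    (\prod_(t0 <- (t :: I)) fine (P (X t0 @^-1` A' t0))))%:E).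
    rewrite big_cons {1}/A' eqxx mulrCA mulrC; congr (_ * _)%:E.
    congr (_ * _); rewrite big_seq [RHS]big_seq.
    by apply: eq_bigr => s sI; rewrite AE.
  rewrite -IHE; apply: eq_integral => w _; rewrite patchE big_cons {1}/A' eqxx.
  rewrite indicE (_ : (w \in X t @^-1` B) = (X t w \in B)); last first.
    by apply/idP/idP => /set_mem ?; exact/mem_set.
  case: ifPn => _ /=; last by rewrite mul0r mulr0.
  rewrite mul1r; congr (_ * _)%:E; rewrite big_seq [RHS]big_seq.
  by apply: eq_bigr => s sI; rewrite AE.
rewrite ge0_integral_mscale//=; last 2 first.
- exact/measurable_EFinP.
- by move=> y _; rewrite lee_fin.
rewrite ge0_integral_distribution//=; last 2 first.
- exact/measurable_EFinP.
- by move=> y; rewrite lee_fin.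
by rewrite gE big_cons -EFinM /c; congr EFin; ring.
Qed.

Lemma independent_expectation (R : realType) (d : measure_display)
    (Omega : measurableType d) (P : probability Omega R)
    (X : nat -> {RV P >-> R}) (g : nat -> R -> R) (G : nat -> R) (J : seq nat) :
  mutually_independent X -> uniq J ->
  (forall t x, 0 <= g t x) -> (forall t, measurable_fun setT (g t)) ->
  (forall t, \int[P]_w (g t (X t w))%:E = (G t)%:E)%E ->
  (\int[P]_w (\prod_(t <- J) g t (X t w))%:E = (\prod_(t <- J) G t)%:E)%E.
Proof.
move=> indX uJ g0 mg gE.
have := @independent_expectation_indic _ _ _ _ X g G J [::] (fun=> setT) indX.
rewrite cats0 => /(_ uJ g0 mg gE (fun=> measurableT)).
rewrite big_nil mulr1 => <-.
by apply: eq_integral => w _; rewrite big_nil mulr1.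
Qed.

(** Completing the square turns the integrand into [k] times the normal density of mean [m] and
    deviation [sigma / Num.sqrt D]. The parameter [s] may be negative as long as D > 0, which the
    upper tail requires. *)
Lemma gaussian_mgf (R : realType) (sigma s a y : R) :
  0 < sigma -> 0 < 1 + 2 * s * (a * sigma) ^+ 2 ->
  (\int[normal_prob 0 sigma]_z (expR (- s * (y - a * z) ^+ 2))%:E =
   ((Num.sqrt (1 + 2 * s * (a * sigma) ^+ 2))^-1 *
    expR (- s * y ^+ 2 / (1 + 2 * s * (a * sigma) ^+ 2)))%:E)%E.
Proof.
move=> s0; set D := 1 + _ => D0.
have mexp : measurable_fun setT (fun z : R => expR (- s * (y - a * z) ^+ 2)).
  apply: (measurableT_comp (f:=@expR R)) => //; apply: measurable_funM => //.
  by apply: measurable_funX; apply: measurable_funB => //.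
have sd0 : sigma / Num.sqrt D != 0.
  by rewrite mulf_neq0 ?invr_eq0 ?gt_eqF// sqrtr_gt0.
transitivity (\int[lebesgue_measure]_x
    (expR (- s * (y - a * x) ^+ 2) * normal_pdf 0 sigma x)%:E)%E.
  apply: (@ge0_integral_density R _ _ (measurableTypeR R) (measurableTypeR R)
    idfun (@measurable_id _ _ _) lebesgue_measure _ (normal_pdf 0 sigma)) => //.
  - by move=> x; exact: normal_pdf_ge0.
  - exact: measurable_normal_pdf.
pose m := 2 * s * a * y * sigma ^+ 2 / D.
pose k := (Num.sqrt D)^-1 * expR (- s * y ^+ 2 / D).
have sqD : Num.sqrt D ^+ 2 = D by rewrite sqr_sqrtr ?ltW.
have sqD0 : Num.sqrt D != 0 by rewrite gt_eqF ?sqrtr_gt0.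
transitivity (\int[lebesgue_measure]_x
  (k%:E * (normal_pdf m (sigma / Num.sqrt D) x)%:E))%E.
  apply: eq_integral => x _; rewrite -EFinM; congr EFin.
  rewrite !normal_pdfE ?(gt_eqF s0)// /normal_fun /normal_peak /k.
  have -> : Num.sqrt ((sigma / Num.sqrt D) ^+ 2 * pi *+ 2) =
            Num.sqrt (sigma ^+ 2 * pi *+ 2) / Num.sqrt D.
    have -> : (sigma / Num.sqrt D) ^+ 2 * pi *+ 2 = (sigma ^+ 2 * pi *+ 2) * D^-1.
      by rewrite expr_div_n sqD mulrAC mulrnAl.
    by rewrite sqrtrM ?sqrtrV ?ltW// mulrn_wgt0// mulr_gt0 ?exprn_gt0 ?pi_gt0.
  have fracE (e1 e2 e3 e4 u v : R) : v != 0 -> e1 * e2 = e3 * e4 ->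
      e1 * (u^-1 * e2) = v^-1 * e3 * ((u / v)^-1 * e4).
    move=> v0 eE; rewrite invf_div mulrCA eE.
    by rewrite [RHS]mulrACA mulrA mulrA mulKf// -mulrA mulrC -mulrA mulrC mulrA.
  apply: fracE => //; rewrite -!expRD; congr expR.
  rewrite expr_div_n sqD /m.
  have D0' : D != 0 by rewrite gt_eqF.
  have s0' : sigma != 0 by rewrite gt_eqF.
  move: D0'; rewrite /D => D0'.
  field.
  by apply/andP; split.
rewrite ge0_integralZl_EFin//.
- by rewrite integral_normal_pdf mule1.
- by move=> x _; rewrite lee_fin normal_pdf_ge0.
- by apply/measurable_EFinP; exact: measurable_normal_pdf.
- by rewrite mulr_ge0 ?expR_ge0// invr_ge0 sqrtr_ge0.
Qed.

Definition sqnorm {R : realType} {n : nat} (x : signal n R) : R :=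
  \sum_(t < n) tnth x t ^+ 2.

(** Serves twice: [a = 1] gives the noise itself, while a = sqrt(q) / sigma gives a random codeword
    of power q per letter. *)
Definition gauss_word {R : realType} {d : measure_display}
    {Omega : measurableType d} {P : probability Omega R} (n : nat) (a : R)
    (Z : nat -> {RV P >-> R}) (w : Omega) : signal n R :=
  [tuple a * Z t w | t < n].

Lemma sqnorm_ge0 (R : realType) (n : nat) (x : signal n R) : 0 <= sqnorm x.
Proof. by apply: sumr_ge0 => t _; exact: sqr_ge0. Qed.

Lemma measurable_sqnorm (R : realType) (d : measure_display)
    (T : measurableType d) (n : nat) (f : T -> signal n R) :
  measurable_fun setT f -> measurable_fun setT (fun w => sqnorm (f w)).
Proof.
move=> mf; rewrite /sqnorm; apply: measurable_sum => t.
apply: measurable_funX; exact: (measurable_fun_tnthP _).1.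
Qed.

Lemma measurable_add_signal (R : realType) (d : measure_display)
    (T : measurableType d) (n : nat) (f g : T -> signal n R) :
  measurable_fun setT f -> measurable_fun setT g ->
  measurable_fun setT (fun w => add_signal (f w) (g w)).
Proof.
move=> mf mg; apply/measurable_fun_tnthP => t.
rewrite (_ : _ \o _ = fun w => tnth (f w) t + tnth (g w) t).
  by apply: measurable_funD; exact: (measurable_fun_tnthP _).1.
by apply/funext => w /=; rewrite tnth_mktuple.
Qed.

Lemma measurable_sub_signal (R : realType) (d : measure_display)
    (T : measurableType d) (n : nat) (f g : T -> signal n R) :
  measurable_fun setT f -> measurable_fun setT g ->
  measurable_fun setT (fun w => sub_signal (f w) (g w)).
Proof.
move=> mf mg; apply/measurable_fun_tnthP => t.
rewrite (_ : _ \o _ = fun w => tnth (f w) t - tnth (g w) t).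
  by apply: measurable_funB; exact: (measurable_fun_tnthP _).1.
by apply/funext => w /=; rewrite tnth_mktuple.
Qed.

Lemma measurable_gauss_word (R : realType) (d : measure_display)
    (Omega : measurableType d) (P : probability Omega R) (n : nat) (a : R)
    (Z : nat -> {RV P >-> R}) : measurable_fun setT (gauss_word n a Z).
Proof.
apply/measurable_fun_tnthP => t.
rewrite (_ : _ \o _ = fun w => a * Z t w).
  by apply: measurable_funM => //; exact: measurable_funP.
by apply/funext => w /=; rewrite tnth_mktuple.
Qed.

Lemma gauss_word_mgf (R : realType) (d : measure_display)
    (Omega : measurableType d) (P : probability Omega R)
    (Z : nat -> {RV P >-> R}) (sigma s a : R) (n : nat) (y : signal n R) :
  0 < sigma -> iid_normal sigma Z -> 0 < 1 + 2 * s * (a * sigma) ^+ 2 ->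
  (\int[P]_w (expR (- s * sqnorm (sub_signal y (gauss_word n a Z w))))%:E =
   ((Num.sqrt (1 + 2 * s * (a * sigma) ^+ 2))^-1 ^+ n *
    expR (- s * sqnorm y / (1 + 2 * s * (a * sigma) ^+ 2)))%:E)%E.
Proof.
move=> sigma0 [indZ distZ]; set D := 1 + _ => D0.
pose g t z := expR (- s * (nth 0 y t - a * z) ^+ 2).
pose G t := (Num.sqrt D)^-1 * expR (- s * (nth 0 y t) ^+ 2 / D).
have mg t : measurable_fun setT (g t).
  apply: (measurableT_comp (f:=@expR R)) => //; apply: measurable_funM => //.
  by apply: measurable_funX; apply: measurable_funB.
have gE t : (\int[P]_w (g t (Z t w))%:E = (G t)%:E)%E.
  have mZ : measurable_fun setT (Z t) by exact: measurable_funP.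
  rewrite -(@gaussian_mgf _ sigma)//.
  rewrite (@ge0_integral_density R _ _ Omega (measurableTypeR R) (Z t) _ P
    (normal_prob 0 sigma) (cst 1) (g t))//.
  - by apply: eq_integral => w _; rewrite mulr1.
  - by move=> z; rewrite expR_ge0.
  - by move=> ? B mB; exact: mg.
  - move=> B mB; transitivity (distribution P (Z t) B); first exact/esym/distZ.
    rewrite (_ : (fun _ => _) = cst 1%E)// integral_cst ?mul1e//.
    by rewrite -[X in measurable X]setTI; exact: mZ.
have := independent_expectation indZ (iota_uniq 0 n) (fun _ _ => expR_ge0 _) mg gE.
have -> : iota 0 n = index_iota 0 n by rewrite /index_iota subn0.
rewrite big_mkord big_split/= prodr_const card_ord => HE.
transitivity (\int[P]_w (\prod_(0 <= t < n) g t (Z t w))%:E)%E.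
  apply: eq_integral => w _; congr EFin; rewrite big_mkord -expR_sum.
  congr expR; rewrite /sqnorm mulr_sumr; apply: eq_bigr => t _.
  by rewrite !tnth_mktuple (tnth_nth 0).
rewrite HE -expR_sum; congr (_ * expR _)%:E.
rewrite /sqnorm mulr_sumr mulr_suml; apply: eq_bigr => t _.
by rewrite (tnth_nth 0).
Qed.

(** Markov's inequality for the exponential: the indicator of [A] is at most exp(k - s |y - x|^2),
    with x the random word. No sign is imposed on [s], so both tails are covered. *)
Lemma gauss_word_chernoff (R : realType) (d : measure_display)
    (Omega : measurableType d) (P : probability Omega R)
    (Z : nat -> {RV P >-> R}) (sigma s a k : R) (n : nat) (y : signal n R)
    (A : set Omega) :
  0 < sigma -> iid_normal sigma Z -> 0 < 1 + 2 * s * (a * sigma) ^+ 2 ->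
  measurable A ->
  (forall w, A w -> s * sqnorm (sub_signal y (gauss_word n a Z w)) <= k) ->
  (P A <= (expR k * ((Num.sqrt (1 + 2 * s * (a * sigma) ^+ 2))^-1 ^+ n *
    expR (- s * sqnorm y / (1 + 2 * s * (a * sigma) ^+ 2))))%:E)%E.
Proof.
move=> sigma0 iidZ D0 mA kA.
rewrite EFinM -(gauss_word_mgf y sigma0 iidZ D0).
have mf : measurable_fun setT
    (fun w => expR (- s * sqnorm (sub_signal y (gauss_word n a Z w)))).
  apply: (measurableT_comp (f:=@expR R)) => //; apply: measurable_funM => //.
  apply: measurable_sqnorm; apply: measurable_sub_signal => //.
  exact: measurable_gauss_word.
rewrite -ge0_integralZl_EFin//; last exact/measurable_EFinP.
rewrite -[X in P X]setIT -integral_indic//; apply: ge0_le_integral => //.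
- by apply/measurable_EFinP; exact: measurable_indic.
- by apply: emeasurable_funM => //; exact/measurable_EFinP.
- move=> w _; rewrite -EFinM lee_fin -expRD indicE.
  have [/set_mem/kA Aw|_] := boolP (w \in A); last by rewrite expR_ge0.
  by rewrite -[leLHS]expR0 ler_expR; lra.
Qed.

(** * Chernoff bounds for a fixed interference vector *)

Definition opp_signal {R : realType} {n : nat} (x : signal n R) : signal n R :=
  [tuple - tnth x t | t < n].

Lemma sqnorm_opp (R : realType) (n : nat) (x : signal n R) :
  sqnorm (opp_signal x) = sqnorm x.
Proof. by apply: eq_bigr => t _; rewrite tnth_mktuple sqrrN. Qed.

Lemma sub_opp_signal (R : realType) (n : nat) (x y : signal n R) :
  sub_signal (opp_signal x) y = opp_signal (add_signal y x).
Proof. by apply: eq_from_tnth => t; rewrite !tnth_mktuple opprD addrC. Qed.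

Lemma measurable_le_set (R : realType) (d : measure_display)
    (T : measurableType d) (f g : T -> R) :
  measurable_fun setT f -> measurable_fun setT g ->
  measurable [set w | f w <= g w].
Proof.
move=> mf mg; rewrite -[X in measurable X]setTI.
exact: (measurable_fun_ler mf mg).
Qed.

(* Depending on the sign of [c - q], this bounds the upper or the lower tail. *)
Lemma deviation_bound (R : realType) (q c N : R) :
  0 < q -> 0 <= c -> 0 <= N -> c != q ->
  exists theta : R, 0 <= theta < 1 /\
  forall (d : measure_display) (Omega : measurableType d)
    (P : probability Omega R) (Z : nat -> {RV P >-> R}) (sigma a : R) (n : nat)
    (w : signal n R),
  0 < sigma -> iid_normal sigma Z -> (a * sigma) ^+ 2 = q ->
  sqnorm w <= n%:R * N ->
  (P [set v | (0 <= (c - q) * (sqnorm (add_signal (gauss_word n a Z v) w) -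
        sqnorm w - n%:R * c))%R] <= (theta ^+ n)%:E)%E.
Proof.
move=> q0 c0 N0 cq.
(* [s] is the Chernoff parameter and e^v / sqrt(D) the ratio per letter. As e^(-2 v) >= 1 - 2 v,
   this ratio is below 1 once D (1 - 2 v) > 1; the excess over 1 is of order (q - c)^2 and positive
   for small [k]. The present [k] ensures 2 k q (c + N) < 1 and keeps D positive. *)
pose k := (4 * q * (c + N + q + 1))^-1.
have e0 : 0 < 4 * q * (c + N + q + 1) by rewrite !mulr_gt0//; lra.
have k0 : 0 < k by rewrite invr_gt0.
have kE : 4 * k * q * (c + N + q + 1) = 1.
  transitivity (k * (4 * q * (c + N + q + 1))); first by ring.
  by rewrite mulVf// lt0r_neq0.
pose s := (q - c) * k; pose D := 1 + 2 * s * q.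
have kq0 : 0 < k * q by rewrite mulr_gt0.
have kqN : 0 <= k * q * N by rewrite mulr_ge0// ltW.
have kqc : 0 <= k * q * c by rewrite mulr_ge0// ltW.
have kqq : 0 <= k * q * q by rewrite !mulr_ge0// ltW.
have D0 : 0 < D by rewrite /D /s; nra.
pose v := s * c + 2 * s ^+ 2 * q * N / D.
have vD : expR (2 * v) < D.
  have e1 : 1 < D * (1 - 2 * v).
    have -> : D * (1 - 2 * v) =
        1 + 2 * (q - c) ^+ 2 * k * (1 - 2 * k * q * (c + N)).
      rewrite /v /D /s; move: (gt_eqF D0); rewrite /D /s => D1.
      by field; rewrite D1.
    have qc2 : 0 < (q - c) ^+ 2.
      by rewrite exprn_even_gt0//= subr_eq0 eq_sym.
    rewrite ltrDl; apply: mulr_gt0; last by lra.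
    by apply: mulr_gt0 => //; apply: mulr_gt0.
  have e2 : 1 - 2 * v <= expR (- (2 * v)) by rewrite expR_ge1Dx.
  have : 1 < D * expR (- (2 * v)).
    by apply: (lt_le_trans e1); rewrite ler_pM2l.
  by rewrite expRN ltr_pdivlMr ?expR_gt0// mul1r.
exists (expR v / Num.sqrt D); split.
  rewrite divr_ge0 ?expR_ge0 ?sqrtr_ge0//=.
  rewrite ltr_pdivrMr ?sqrtr_gt0// mul1r -(@ltr_sqr _ (expR v)) ?nnegrE ?expR_ge0//.
  by rewrite sqr_sqrtr ?ltW// -expRM_natl// ltW.
move=> d Omega P Z sigma a n w sigma0 iidZ aq wN.
have D0' : 0 < 1 + 2 * s * (a * sigma) ^+ 2 by rewrite aq.
have mA : measurable [set v0 | 0 <= (c - q) *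
    (sqnorm (add_signal (gauss_word n a Z v0) w) - sqnorm w - n%:R * c)].
  apply: measurable_le_set => //; apply: measurable_funM => //.
  apply: measurable_funB => //; apply: measurable_funB => //.
  apply: measurable_sqnorm; apply: measurable_add_signal => //.
  exact: measurable_gauss_word.
apply: (le_trans (@gauss_word_chernoff _ _ _ _ Z sigma s a
  (s * (sqnorm w + n%:R * c)) n (opp_signal w) _ sigma0 iidZ D0' mA _)).
  move=> v0 /= Av; rewrite sub_opp_signal sqnorm_opp.
  rewrite -subr_le0 -mulrBr /s; move: Av k0; set S := sqnorm _.
  nra.
rewrite lee_fin sqnorm_opp aq -/D mulrCA mulrC -expRD.
rewrite expr_div_n mulrC exprVn mulrC ler_pM2r ?invr_gt0 ?exprn_gt0 ?sqrtr_gt0//.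
rewrite -expRM_natl ler_expR.
have -> : s * (sqnorm w + n%:R * c) + - s * sqnorm w / D =
    n%:R * (s * c) + sqnorm w * (2 * s ^+ 2 * q / D).
  by rewrite /D; field; rewrite gt_eqF.
rewrite /v mulrDr lerD2l.
have -> : 2 * s ^+ 2 * q * N / D = N * (2 * s ^+ 2 * q / D) by ring.
rewrite [leRHS]mulrA ler_wpM2r// divr_ge0 ?(ltW D0)// mulr_ge0 ?(ltW q0)//.
by rewrite mulr_ge0 ?sqr_ge0.
Qed.

(* Chernoff's bound with parameter [1 / (2 N)]. It would still involve the power
   [q] of the codeword, through a factor [exp ((q - c) / (2 (N + q)))] which
   [1 + t <= exp t] absorbs. *)
Lemma pairwise_error_bound (R : realType) (d : measure_display)
    (Omega : measurableType d) (P : probability Omega R)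
    (Z : nat -> {RV P >-> R}) (sigma a c N W : R) (n : nat) (y : signal n R) :
  0 < sigma -> iid_normal sigma Z -> 0 <= c -> 0 < N ->
  W <= n%:R * N -> W + n%:R * c <= sqnorm y ->
  (P [set v | (sqnorm (sub_signal y (gauss_word n a Z v)) <= W)%R] <=
   ((Num.sqrt (1 + c / N))^-1 ^+ n)%:E)%E.
Proof.
move=> sigma0 iidZ c0 N0 WN yW.
pose q := (a * sigma) ^+ 2; have q0 : 0 <= q by rewrite sqr_ge0.
pose s := (2 * N)^-1.
have s0 : 0 < s by rewrite invr_gt0 mulr_gt0.
have DE : 1 + 2 * s * (a * sigma) ^+ 2 = 1 + q / N.
  by rewrite -/q /s; field; rewrite gt_eqF.
have D0 : 0 < 1 + q / N by rewrite ltr_wpDr// divr_ge0// ltW.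
have C0 : 0 < 1 + c / N by rewrite ltr_wpDr// divr_ge0// ltW.
have mA : measurable [set v | sqnorm (sub_signal y (gauss_word n a Z v)) <= W].
  apply: measurable_le_set => //.
  apply: measurable_sqnorm; apply: measurable_sub_signal => //.
  exact: measurable_gauss_word.
have := @gauss_word_chernoff _ _ _ _ Z sigma s a (s * W) n y _ sigma0 iidZ _ mA.
rewrite DE => /(_ D0) H; apply: (le_trans (H _)).
  by move=> v /= Av; rewrite ler_pM2l.
have Nq0 : 0 < N + q by rewrite ltr_wpDr.
pose u := (q - c) / (2 * (N + q)).
rewrite lee_fin; apply: (@le_trans _ _ ((expR u / Num.sqrt (1 + q / N)) ^+ n)).
  rewrite mulrCA mulrC -expRD expr_div_n exprVn.
  rewrite ler_pM2r ?invr_gt0 ?exprn_gt0 ?sqrtr_gt0//.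
  rewrite -expRM_natl ler_expR.
  have -> : - s * sqnorm y / (1 + q / N) = - sqnorm y / (2 * (N + q)).
    by rewrite /s; field; rewrite !gt_eqF.
  apply: (@le_trans _ _ (s * W - (W + n%:R * c) / (2 * (N + q)))).
    by rewrite lerD2l mulNr lerN2 ler_pM2r// invr_gt0 mulr_gt0.
  have -> : s * W - (W + n%:R * c) / (2 * (N + q)) =
      W * (q / (2 * N * (N + q))) - n%:R * c / (2 * (N + q)).
    by rewrite /s; field; rewrite !gt_eqF.
  have -> : n%:R * u = n%:R * N * (q / (2 * N * (N + q))) - n%:R * c / (2 * (N + q)).
    by rewrite /u; field; rewrite !gt_eqF.
  by rewrite lerD2r ler_wpM2r// divr_ge0// !mulr_ge0// ltW.
apply: lerXn2r; rewrite ?nnegrE ?invr_ge0 ?divr_ge0 ?expR_ge0 ?sqrtr_ge0//.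
rewrite -ler_sqr ?nnegrE ?invr_ge0 ?divr_ge0 ?expR_ge0 ?sqrtr_ge0//.
rewrite expr_div_n exprVn !sqr_sqrtr ?(ltW D0) ?(ltW C0)// -expRM_natl.
rewrite ler_pdivrMr// [leRHS]mulrC ler_pdivlMr//.
have e1 : 1 - 2%:R * u <= expR (- (2%:R * u)) by rewrite expR_ge1Dx.
have e2 : (1 + c / N) = (1 + q / N) * (1 - 2%:R * u).
  by rewrite /u; field; rewrite !gt_eqF.
rewrite e2 mulrCA -[leRHS]mulr1 ler_pM2l// -[leRHS](expRxMexpNx_1 (2%:R * u)).
by rewrite ler_pM2l// expR_gt0.
Qed.

(** * Averaging over codebooks *)

Lemma integral_lt_exists (R : realType) (d : measure_display)
    (T : measurableType d) (P : probability T R) (f : T -> \bar R) (c : \bar R) :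
  (forall x, (0 <= f x)%E) -> measurable_fun setT f ->
  (\int[P]_x f x < c)%E -> exists x, (f x < c)%E.
Proof.
move=> f0 mf fc; apply: contrapT => H.
have cf x : (c <= f x)%E.
  by rewrite leNgt; apply/negP => fxc; apply: H; exists x.
have c0 : (0 <= c)%E.
  by apply: (le_trans _ (ltW fc)); apply: integral_ge0 => x _; exact: f0.
suff : (c <= \int[P]_x f x)%E by rewrite leNgt fc.
have <- : (\int[P]_x cst c x = c)%E.
  by rewrite integral_cst//= probability_setT mule1.
by apply: ge0_le_integral => // x _; exact: c0.
Qed.

(** Tonelli's theorem integrates over the codeword first, with the interference fixed. This is how
    bounds uniform in the interference become bounds on the average over codewords. *)
Lemma integral_section_le (R : realType) (d1 d2 : measure_display)
    (T1 : measurableType d1) (T2 : measurableType d2) (P1 : probability T1 R)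
    (P2 : probability T2 R) (A : set (T1 * T2)) (b : \bar R) :
  measurable A -> (forall y, P1 [set x | A (x, y)] <= b)%E ->
  (\int[P1]_x P2 [set y | A (x, y)] <= b)%E.
Proof.
move=> mA Ab.
have xE x : xsection A x = [set y | A (x, y)].
  by apply/seteqP; split => y; rewrite /xsection/= ?inE// => ?; rewrite inE.
have yE y : ysection A y = [set x | A (x, y)].
  by apply/seteqP; split => x; rewrite /ysection/= ?inE// => ?; rewrite inE.
have b0 : (0 <= b)%E by apply: le_trans (Ab point); exact: measure_ge0.
have := indic_fubini_tonelli P1 P2 mA.
rewrite indic_fubini_tonelli_FE// indic_fubini_tonelli_GE//.
under eq_integral do rewrite /= xE.
move=> ->; apply: (@le_trans _ _ (\int[P2]_x cst b x)%E).
  apply: ge0_le_integral => //.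
  - exact: measurable_fun_ysection.
  - by move=> y _ /=; rewrite yE; exact: Ab.
by rewrite integral_cst//= probability_setT mule1.
Qed.

(** The probabilistic method without an [M]-fold product space: since the objective involves at most
    two words at a time, the words can be fixed one by one, each by a single integral over [T]. *)
Lemma exists_le_expectation (R : realType) (d : measure_display)
    (T : measurableType d) (P : probability T R) (M : nat)
    (g : nat -> T -> \bar R) (h : nat -> nat -> T * T -> \bar R) (c b : \bar R) :
  (0 <= c)%E ->
  (forall j x, 0 <= g j x)%E -> (forall j, measurable_fun setT (g j)) ->
  (forall j k x, 0 <= h j k x)%E -> (forall j k, measurable_fun setT (h j k)) ->
  (forall j x, h j j x = 0)%E ->
  (c + \sum_(j < M) \int[P]_x g j x +
   \sum_(j < M) \sum_(k < M) \int[P]_x \int[P]_y h j k (x, y) < b)%E ->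
  exists x : nat -> T,
    (c + \sum_(j < M) g j (x j) +
     \sum_(j < M) \sum_(k < M) h j k (x j, x k) < b)%E.
Proof.
move=> + + + h0 mh hjj; elim: M g c => [|M IH] g c c0 g0 mg.
  by rewrite !big_ord0 => H; exists (fun=> point); rewrite !big_ord0.
pose k1 j x := (\int[P]_y h j M (x, y))%E.
pose k2 j x := (\int[P]_y h M j (y, x))%E.
have k10 j x : (0 <= k1 j x)%E by apply: integral_ge0.
have k20 j x : (0 <= k2 j x)%E by apply: integral_ge0.
have mk1 j : measurable_fun setT (k1 j).
  exact: (measurable_fun_fubini_tonelli_F (h j M)).
have mk2 j : measurable_fun setT (k2 j).
  exact: (measurable_fun_fubini_tonelli_G (h M j)).
have Ik2 j : (\int[P]_x k2 j x = \int[P]_x \int[P]_y h M j (x, y))%E.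
  by rewrite (fubini_tonelli (h M j)).
have recE (f : nat -> nat -> \bar R) : (f M M = 0 ->
  \sum_(j < M.+1) \sum_(k < M.+1) f j k =
  \sum_(j < M) \sum_(k < M) f j k + \sum_(j < M) (f j M + f M j))%E.
  move=> fM; rewrite big_ord_recr/= big_ord_recr/= fM adde0.
  under eq_bigr do rewrite big_ord_recr/=.
  by rewrite !big_split/= addeA.
rewrite big_ord_recr/= (recE (fun j k => \int[P]_x \int[P]_y h j k (x, y))%E);
    last first.
  by rewrite integral0_eq// => x _; rewrite integral0_eq// => y _; rewrite hjj.
have AC1 (x y z t u : \bar R) :
    (x + y + (z + t) + u = x + (z + y) + (u + t))%E.
  by rewrite -!addeA; congr (_ + _)%E; rewrite addeCA (addeC t).
have AC2 (x y z t u : \bar R) :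
    (x + z + u + (y + t) = x + y + (z + t) + u)%E.
  by rewrite -!addeA; congr (_ + _)%E; rewrite [RHS]addeCA; congr (_ + _)%E; rewrite addeC -addeA.
have AC3 (x y z t u : \bar R) :
    (x + (z + y) + (u + t) = x + z + u + (y + t))%E.
  by rewrite -!addeA; congr (_ + (_ + _))%E; rewrite addeCA.
(* The last word is averaged out: its own term joins the constant and its interactions with word j,
   namely [k1 j] and [k2 j], join [g j]. Once the others are fixed, [y] is chosen for it. *)
move=> Hb.
have := IH (fun j x => g j x + (k1 j x + k2 j x))%E (c + \int[P]_x g M x)%E.
case.
- by rewrite adde_ge0// integral_ge0.
- by move=> j x; apply: adde_ge0; [exact: g0|apply: adde_ge0; [exact: k10|exact: k20]].
- by move=> j; apply: emeasurable_funD => //; exact: emeasurable_funD.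
- apply: le_lt_trans Hb; rewrite le_eqVlt; apply/orP; left; apply/eqP.
  rewrite [X in (_ + X + _)%E = _](_ : _ = \sum_(j < M) \int[P]_x g j x +
    \sum_(j < M) (\int[P]_x k1 j x + \int[P]_x k2 j x))%E; last first.
    rewrite -big_split/=; apply: eq_bigr => j _.
    rewrite ge0_integralD//; last 2 first.
    + by move=> x _; rewrite adde_ge0.
    + exact: emeasurable_funD.
    by congr (_ + _)%E; rewrite ge0_integralD.
  under [X in (_ + (_ + X) + _)%E = _]eq_bigr do rewrite Ik2.
  exact: AC1.
move=> x Hx.
pose F y := (c + \sum_(j < M) g j (x j) +
    \sum_(j < M) \sum_(k < M) h j k (x j, x k) +
    (g M y + \sum_(j < M) (h j M (x j, y) + h M j (y, x j))))%E.
have mh1 j : measurable_fun setT (fun y => h j M (x j, y)).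
  exact: measurableT_comp.
have mh2 j : measurable_fun setT (fun y => h M j (y, x j)).
  exact: measurableT_comp.
have s0 : (0 <= c + \sum_(j < M) g j (x j) +
    \sum_(j < M) \sum_(k < M) h j k (x j, x k))%E.
  by rewrite !adde_ge0// sume_ge0// => j _; rewrite sume_ge0.
have mS : measurable_fun setT
    (fun y => \sum_(j < M) (h j M (x j, y) + h M j (y, x j)))%E.
  apply: emeasurable_sum => j; exact: emeasurable_funD.
have S0 y : (0 <= \sum_(j < M) (h j M (x j, y) + h M j (y, x j)))%E.
  by rewrite sume_ge0// => j _; rewrite adde_ge0.
have [|||y Fy] := @integral_lt_exists _ _ _ P F b.
- by move=> y; apply: adde_ge0 => //; apply: adde_ge0.
- by apply: emeasurable_funD => //; exact: emeasurable_funD.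
- apply: le_lt_trans Hx; rewrite le_eqVlt; apply/orP; left; apply/eqP.
  rewrite ge0_integralD//; last 2 first.
  + by move=> y _; rewrite adde_ge0.
  + exact: emeasurable_funD.
  rewrite integral_cst//= probability_setT mule1 ge0_integralD// ge0_integral_sum//; last 2 first.
  + by move=> j; exact: emeasurable_funD.
  + by move=> j y _; rewrite adde_ge0.
  rewrite [in RHS]big_split/=.
  rewrite [X in (_ + (_ + X))%E = _](_ : _ =
      \sum_(j < M) (k1 j (x j) + k2 j (x j)))%E; last first.
    by apply: eq_bigr => j _; rewrite ge0_integralD.
  exact: AC2.
pose x' j := if j == M then y else x j.
exists x'; rewrite (recE (fun j k => h j k (x' j, x' k))) ?hjj//.
rewrite big_ord_recr/= /x' eqxx.
have xE (j : 'I_M) : (if j == M :> nat then y else x j) = x j by rewrite ltn_eqF.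
under eq_bigr do rewrite xE.
under [X in (_ + (X + _))%E]eq_bigr do under eq_bigr do rewrite !xE.
under [X in (_ + (_ + X))%E]eq_bigr do rewrite !xE.
apply: le_lt_trans Fy; rewrite le_eqVlt; apply/orP; left; apply/eqP.
exact: AC3.
Qed.

Lemma emeasurable_sum_cond (R : realType) (d : measure_display)
    (T : measurableType d) (I : finType) (Q : pred I) (f : I -> T -> \bar R) :
  (forall i, measurable_fun setT (f i)) ->
  measurable_fun setT (fun x => \sum_(i | Q i) f i x)%E.
Proof.
by move=> mf; under eq_fun do rewrite -big_filter; exact: emeasurable_sum.
Qed.

(** An element of [E] is a situation (which receiver, which messages) in which word [idx e] is sent.
    [A e] is a failure caused by that word alone, [A2 e] one caused by a single rival, and the union
    bound over at most [M] rivals gives the term [M%:R * be]. Rivals have a different index, hence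
    are sampled independently of the sent word. *)
Lemma random_codebook (R : realType) (d d' : measure_display)
    (T : measurableType d) (T' : measurableType d') (P : probability T R)
    (P' : probability T' R) (E : finType) (M : nat) (idx : E -> nat)
    (A : E -> set (T * T')) (A2 : E -> set (T * T * T')) (al be b : R) :
  (forall e, (idx e < M)%N) ->
  (forall e, measurable (A e)) -> (forall e, measurable (A2 e)) ->
  (forall e v, P [set x | A e (x, v)] <= al%:E)%E ->
  (forall e x v, P [set y | A2 e (x, y, v)] <= be%:E)%E ->
  0 <= be -> #|E|%:R * (al + M%:R * be) < b ->
  exists x : nat -> T,
  (\sum_e (P' [set v | A e (x (idx e), v)] +
    \sum_(k < M | k != idx e :> nat) P' [set v | A2 e (x (idx e), x k, v)])
   < b%:E)%E.
Proof.
move=> idxM mA mA2 Aal A2be be0 Hb.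
(* Situations are grouped by the word that they send, so that [g] and [h] depend on one and two
   words. *)
pose g j x := (\sum_(e | idx e == j) P' [set v | A e (x, v)])%E.
pose h j k (x : T * T) := (\sum_(e | (idx e == j) && (k != j))
  P' [set v | A2 e (x.1, x.2, v)])%E.
have AE e x : [set v | A e (x, v)] = xsection (A e) x.
  by apply/seteqP; split => y; rewrite /xsection/= ?inE// => ?; rewrite inE.
have A2E e (x : T * T) : [set v | A2 e (x.1, x.2, v)] = xsection (A2 e) x.
  by apply/seteqP; split => y; case: x => x1 x2; rewrite /xsection/= ?inE// => ?; rewrite inE.
have mPA e : measurable_fun setT (fun x => P' [set v | A e (x, v)]).
  under eq_fun do rewrite AE.
  exact: (measurable_fun_xsection P').
have mPA2 e : measurable_fun setT
    (fun x : T * T => P' [set v | A2 e (x.1, x.2, v)]).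
  under eq_fun do rewrite A2E.
  exact: (measurable_fun_xsection P').
have mA2x e x : measurable [set z : T * T' | A2 e (x, z.1, z.2)].
  have mf : measurable_fun setT (fun z : T * T' => (x, z.1, z.2)).
    by apply: measurable_fun_pair => //; apply: measurable_fun_pair.
  by rewrite -[X in measurable X]setTI; exact: mf.
have Ig j : (\int[P]_x g j x <= (\sum_(e | idx e == j) al)%:E)%E.
  under eq_integral do rewrite /g -big_filter.
  rewrite ge0_integral_sum// big_filter -sumEFin; apply: lee_sum => e _.
  exact: integral_section_le.
have Ih j k : (\int[P]_x \int[P]_y h j k (x, y) <=
    (\sum_(e | (idx e == j) && (k != j)) be)%:E)%E.
  apply: (@le_trans _ _ (\int[P]_x cst
      (\sum_(e | (idx e == j) && (k != j)) be)%:E x)%E); last first.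
    by rewrite integral_cst//= probability_setT mule1.
  apply: ge0_le_integral => //.
  - by move=> x _; apply: integral_ge0 => y _; exact: sume_ge0.
  - apply: (measurable_fun_fubini_tonelli_F (h j k)).
    + exact: emeasurable_sum_cond.
    + by move=> x; exact: sume_ge0.
  - move=> x _ /=; under eq_integral do rewrite /h -big_filter.
    rewrite ge0_integral_sum//=; last first.
      by move=> e; exact: measurableT_comp (mPA2 e) (measurable_pair1 x).
    rewrite big_filter -sumEFin; apply: lee_sum => e _.
    apply: (@integral_section_le _ _ _ _ _ P P'
      [set z : T * T' | A2 e (x, z.1, z.2)] _ (mA2x e x)) => v.
    exact: A2be.
have [|||||||x Hx] := @exists_le_expectation _ _ _ P M g h 0 b%:E.
- by [].
- by move=> j x; exact: sume_ge0.
- by move=> j; exact: emeasurable_sum_cond.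
- by move=> j k x; exact: sume_ge0.
- by move=> j k; exact: emeasurable_sum_cond.
- by move=> j x; rewrite /h big1// => e /andP[_]; rewrite eqxx.
- rewrite add0e; apply: (@le_lt_trans _ _
    ((\sum_(j < M) \sum_(e | idx e == j) al) +
     \sum_(j < M) \sum_(k < M) \sum_(e | (idx e == j) && (k != j :> nat)) be)%:E).
    rewrite EFinD -!sumEFin; apply: leeD; first by apply: lee_sum => j _.
    by apply: lee_sum => j _; rewrite -sumEFin; apply: lee_sum => k _.
  rewrite lte_fin; apply: le_lt_trans Hb.
  have idxE (F : E -> R) : \sum_(j < M) \sum_(e | idx e == j) F e = \sum_e F e.
    by rewrite [RHS](partition_big (fun e => Ordinal (idxM e)) xpredT).
  rewrite idxE sumr_const mulrDr mulr_natl lerD2l.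
  apply: (@le_trans _ _ (\sum_(j < M) \sum_(e | idx e == j) M%:R * be)).
    apply: ler_sum => j _; rewrite -mulr_sumr mulr_natl.
    have -> (z : R) : z *+ M = \sum_(k < M) z by rewrite sumr_const card_ord.
    apply: ler_sum => k _.
    by rewrite big_mkcondr/=; apply: ler_sum => e _; case: ifP.
  by rewrite idxE sumr_const -[leLHS]mulr_natl.
exists x; apply: le_lt_trans Hx; rewrite add0e.
rewrite big_split/=; apply: leeD.
  rewrite (partition_big (fun e => Ordinal (idxM e)) xpredT)//=.
  apply: lee_sum => j _; rewrite /g le_eqVlt; apply/orP; left; apply/eqP.
  apply: eq_big => [e|e /eqP <-//].
  by rewrite -val_eqE.
rewrite (partition_big (fun e => Ordinal (idxM e)) xpredT)//=.
apply: lee_sum => j _.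
rewrite (eq_bigr (fun e => \sum_(k < M | k != j) P' [set v | A2 e (x j, x k, v)])%E); last first.
  by move=> e /eqP <-.
rewrite exchange_big//= big_mkcond/=; apply: lee_sum => k _.
case: ifPn => kj; last exact: sume_ge0.
rewrite /h le_eqVlt; apply/orP; left; apply/eqP; apply: eq_bigl => e.
by rewrite kj andbT.
Qed.

(** * Codebooks of exact power *)

Definition zero_signal {R : realType} {n : nat} : signal n R := [tuple 0 | t < n].

Definition sgn_signal {R : realType} {n : nat} (b : bool) (x : signal n R) :
  signal n R := [tuple (-1) ^+ b * tnth x t | t < n].

Lemma sqnorm_zero (R : realType) (n : nat) : sqnorm (zero_signal : signal n R) = 0.
Proof. by rewrite /sqnorm big1// => t _; rewrite tnth_mktuple expr0n. Qed.

Lemma sqnorm_sgn (R : realType) (n : nat) (b : bool) (x : signal n R) :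
  sqnorm (sgn_signal b x) = sqnorm x.
Proof. by apply: eq_bigr => t _; rewrite tnth_mktuple exprMn sqrr_sign mul1r. Qed.

Lemma sqnorm_parallelogram (R : realType) (n : nat) (x y : signal n R) :
  sqnorm (add_signal x y) + sqnorm (sub_signal x y) = 2 * sqnorm x + 2 * sqnorm y.
Proof.
rewrite /sqnorm !mulr_sumr -!big_split/=; apply: eq_bigr => t _.
by rewrite !tnth_mktuple; ring.
Qed.

Definition truncate {R : realType} {n : nat} (cap : R) (x : signal n R) :
  signal n R := if sqnorm x <= n%:R * cap then x else zero_signal.

Lemma sqnorm_truncate (R : realType) (n : nat) (cap : R) (x : signal n R) :
  0 <= cap -> sqnorm (truncate cap x) <= n%:R * cap.
Proof.
by move=> cap0; rewrite /truncate; case: ifP => // _; rewrite sqnorm_zero mulr_ge0.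
Qed.

(** The boolean is the sign, so that opposite codewords differ in it alone. *)
Definition book_index (M : nat) : finType := (bool * option 'I_M)%type.

(* The power missing from the truncated codewords; the codeword [None] makes up
   for it. *)
Definition deficit {R : realType} {n : nat} (M : nat) (p cap : R)
    (x : nat -> signal n R) : R :=
  M.+1%:R * (n%:R * p) - \sum_(j < M) sqnorm (truncate cap (x j)).

Definition base_word {R : realType} {n M : nat} (p cap : R)
    (x : nat -> signal n R) (o : option 'I_M) : signal n R :=
  if o is Some j then truncate cap (x j)
  else [tuple Num.sqrt (deficit M p cap x / n%:R) | t < n].

Definition book_word {R : realType} {n M : nat} (p cap : R)
    (x : nat -> signal n R) (v : book_index M) : signal n R :=
  sgn_signal v.1 (base_word p cap x v.2).

Lemma card_book_index (M : nat) : #|book_index M| = (2 * M.+1)%N.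
Proof. by rewrite card_prod card_bool card_option card_ord. Qed.

(** Truncation leaves each of the [M] words short by at least n (p - cap). The norm of the [None]
    words therefore grows with [M], which is what sends them far away. *)
Lemma deficit_ge (R : realType) (n M : nat) (p cap : R) (x : nat -> signal n R) :
  0 <= cap -> 0 <= p ->
  M%:R * (n%:R * (p - cap)) <= deficit M p cap x.
Proof.
move=> cap0 p0; rewrite /deficit lerBrDr -lerBrDl.
apply: (@le_trans _ _ (\sum_(j < M) n%:R * cap)).
  by apply: ler_sum => j _; exact: sqnorm_truncate.
rewrite sumr_const card_ord -[leLHS]mulr_natl.
have : 0 <= n%:R * p by rewrite mulr_ge0.
by rewrite -natr1 => ?; lra.
Qed.

Lemma sqnorm_garbage (R : realType) (n M : nat) (p cap : R)
    (x : nat -> signal n R) :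
  (0 < n)%N -> 0 <= cap -> cap <= p ->
  sqnorm (base_word p cap x (@None 'I_M)) = deficit M p cap x.
Proof.
move=> n0 cap0 capp; have p0 := le_trans cap0 capp.
have d0 : 0 <= deficit M p cap x.
  apply: le_trans (deficit_ge M x cap0 p0).
  by rewrite !mulr_ge0// subr_ge0.
rewrite /sqnorm /base_word.
under eq_bigr do rewrite tnth_mktuple sqr_sqrtr ?divr_ge0//.
by rewrite sumr_const card_ord -[LHS]mulr_natr divfK// pnatr_eq0 -lt0n.
Qed.

Lemma book_power (R : realType) (n M : nat) (p cap : R) (x : nat -> signal n R) :
  (0 < n)%N -> 0 <= cap -> cap <= p ->
  \sum_(v : book_index M) sqnorm (book_word p cap x v) =
  #|book_index M|%:R * (n%:R * p).
Proof.
move=> n0 cap0 capp; rewrite card_book_index.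
rewrite -(pair_bigA _ (fun b o => sqnorm (book_word p cap x (b, o))))/=.
rewrite big_bool/= /book_word/=.
under eq_bigr do rewrite sqnorm_sgn.
under [X in _ + X]eq_bigr do rewrite sqnorm_sgn.
have -> : \sum_(o : option 'I_M) sqnorm (base_word p cap x o) =
    M.+1%:R * (n%:R * p).
  rewrite (bigD1 None)//= (reindex_omap Some id) /=; last by case.
  rewrite (eq_bigl xpredT); last by move=> j; rewrite eqxx.
  by rewrite sqnorm_garbage// /deficit subrK.
by rewrite natrM; ring.
Qed.

Lemma book_word_neg (R : realType) (n M : nat) (p cap : R)
    (x : nat -> signal n R) (v : book_index M) :
  book_word p cap x (~~ v.1, v.2) = opp_signal (book_word p cap x v).
Proof.
apply: eq_from_tnth => t; rewrite !tnth_mktuple /=.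
by case: v.1; rewrite ?expr1 ?expr0 ?mulN1r ?mul1r ?opprK.
Qed.

(* The last three alternatives say that [y] leaves too much power to the next
   sub-channel, that it is too close to [w] for the codewords [0] and
   [- x j] to be excluded, and that it is closer to some other codeword. *)
Definition layer_bad {R : realType} {n : nat} (M : nat) (c cap p N : R)
    (acc : bool) (x : nat -> signal n R) (b : bool) (j : nat) (w : signal n R) :
    Prop :=
  let y := add_signal (sgn_signal b (x j)) w in
  sqnorm w <= n%:R * N /\
  [\/ n%:R * cap <= sqnorm (x j), sqnorm w + n%:R * p <= sqnorm y,
      sqnorm y <= sqnorm w + n%:R * c |
      [/\ acc, sqnorm w + n%:R * c <= sqnorm y &
      exists k, [/\ (k < M)%N, k != j & exists b', sqnorm (sub_signal y
        (sgn_signal b' (x k))) <= sqnorm w]]].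

Lemma not_layer_bad (R : realType) (n M : nat) (c cap p N : R) (acc : bool)
    (x : nat -> signal n R) (b : bool) (j : 'I_M) (w : signal n R) :
  0 <= c -> sqnorm w <= n%:R * N ->
  ~ layer_bad M c cap p N acc x b j w ->
  let y := add_signal (book_word p cap x (b, Some j)) w in
  [/\ book_word p cap x (b, Some j) = sgn_signal b (x j),
      sqnorm y <= n%:R * (N + p) & sqnorm w < sqnorm y].
Proof.
move=> c0 wN nbad.
have xcap : sqnorm (x j) < n%:R * cap.
  by rewrite ltNge; apply/negP => H; apply: nbad; split => //; constructor 1.
have jE : book_word p cap x (b, Some j) = sgn_signal b (x j).
  by rewrite /book_word/= /truncate (ltW xcap).
have yp : sqnorm (add_signal (sgn_signal b (x j)) w) < sqnorm w + n%:R * p.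
  by rewrite ltNge; apply/negP => H; apply: nbad; split => //; constructor 2.
have yc : sqnorm w + n%:R * c < sqnorm (add_signal (sgn_signal b (x j)) w).
  by rewrite ltNge; apply/negP => H; apply: nbad; split => //; constructor 3.
rewrite /= jE; split => //.
  by rewrite mulrDr; apply: (le_trans (ltW yp)); rewrite lerD2r.
by apply: le_lt_trans yc; rewrite lerDl mulr_ge0.
Qed.

(** The sent word is at distance exactly |w| from the output, so strict inequality excludes ties. Of
    the four kinds of rivals ([None], opposite, truncated to 0, intact), only the last requires an
    estimate on pairs of random words. *)
Lemma book_separation (R : realType) (n M : nat) (c cap p N : R)
    (x : nat -> signal n R) (b : bool) (j : 'I_M) (w : signal n R)
    (v : book_index M) :
  (0 < n)%N -> 0 <= c -> 0 <= cap -> cap < p -> 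
  4 * (N + p) < M%:R * (p - cap) ->
  sqnorm w <= n%:R * N -> ~ layer_bad M c cap p N true x b j w ->
  v != (b, Some j) ->
  sqnorm w < sqnorm (sub_signal (add_signal (book_word p cap x (b, Some j)) w)
                       (book_word p cap x v)).
Proof.
move=> n0 c0 cap0 capp Mbig wN nbad.
have [jE yNp wy] := not_layer_bad c0 wN nbad.
move: yNp wy; rewrite jE.
set y := add_signal (sgn_signal b (x j)) w => yNp wy.
have p0 : 0 <= p by rewrite (le_trans cap0)// ltW.
case: v => b' [k|] vE /=; last first.
  have gE : sqnorm (book_word p cap x (b', @None 'I_M)) = deficit M p cap x.
    by rewrite /book_word sqnorm_sgn sqnorm_garbage// ltW.
  have g1 : 4 * (n%:R * (N + p)) < deficit M p cap x.
    apply: lt_le_trans (deficit_ge M x cap0 p0).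
    by rewrite mulrCA [ltRHS]mulrCA ltr_pM2l// ltr0n.
  set g := book_word p cap x _ in gE *.
  (* |y - g|^2 >= |g|^2 / 2 - |y|^2 with |y|^2 <= n (N + p): hence the factor 4 in the hypothesis on
     [M]. *)
  have := sqnorm_parallelogram (sub_signal y g) y.
  have -> : sqnorm (sub_signal (sub_signal y g) y) = sqnorm g.
    by apply: eq_bigr => t _; rewrite !tnth_mktuple; ring.
  have := sqnorm_ge0 (add_signal (sub_signal y g) y).
  have : n%:R * N <= n%:R * (N + p) by rewrite ler_wpM2l// lerDl.
  rewrite gE; lra.
have [kj|kj] := eqVneq (k : nat) j.
  have bE : b' = ~~ b.
    move: vE; rewrite (_ : k = j) ?xpair_eqE ?eqxx ?andbT; last exact: val_inj.
    by case: b b' {jE y yNp wy nbad} => -[].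
  have -> : k = j by exact: val_inj.
  rewrite bE -[b]/((b, Some j).1) -[Some j]/((b, Some j).2) book_word_neg jE.
  (* With x the sent word, |y + x|^2 = 2 |y|^2 + 2 |x|^2 - |w|^2, which exceeds |w|^2 because |y| >
     |w|. *)
  have := sqnorm_parallelogram y (sgn_signal b (x j)).
  have -> : sqnorm (sub_signal y (sgn_signal b (x j))) = sqnorm w.
    by apply: eq_bigr => t _; rewrite !tnth_mktuple; ring.
  have -> : sqnorm (sub_signal y (opp_signal (sgn_signal b (x j)))) =
      sqnorm (add_signal y (sgn_signal b (x j))).
    by apply: eq_bigr => t _; rewrite !tnth_mktuple; ring.
  have := sqnorm_ge0 (sgn_signal b (x j)).
  lra.
(* A rival truncated to 0 is at distance |y| > |w|; an intact one falls under the last alternative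
   of [layer_bad]. *)
rewrite /book_word/= /truncate; case: ifP => _; last first.
  rewrite (_ : sqnorm (sub_signal _ _) = sqnorm y)//.
  by apply: eq_bigr => t _; rewrite !tnth_mktuple; ring.
rewrite ltNge; apply/negP => H; apply: (nbad); split => //; constructor 4.
split => //; last by exists k; split => //; exists b'.
by rewrite leNgt; apply/negP => /ltW H'; apply: nbad; split => //; constructor 3.
Qed.

(** * Measurability of the bad events and choice of one codebook *)

Lemma measurable_sgn_signal (R : realType) (d : measure_display)
    (T : measurableType d) (n : nat) (b : bool) (f : T -> signal n R) :
  measurable_fun setT f -> measurable_fun setT (fun w => sgn_signal b (f w)).
Proof.
move=> mf; apply/measurable_fun_tnthP => t.
rewrite (_ : _ \o _ = fun w => (-1) ^+ b * tnth (f w) t).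
  by apply: measurable_funM => //; exact: (measurable_fun_tnthP _).1.
by apply/funext => w /=; rewrite tnth_mktuple.
Qed.

Lemma measurable_const_set (d : measure_display) (T : measurableType d)
    (Q : Prop) : measurable [set _ : T | Q].
Proof.
have [q|nq] := pselect Q.
  by rewrite (_ : [set _ | Q] = setT)//; apply/seteqP; split.
by rewrite (_ : [set _ | Q] = set0)//; apply/seteqP; split.
Qed.

Lemma measurable_ex_set (d : measure_display) (T : measurableType d)
    (I : countType) (F : I -> T -> Prop) :
  (forall i, measurable [set v | F i v]) ->
  measurable [set v | exists i, F i v].
Proof.
move=> mF; rewrite (_ : mkset _ = \bigcup_(i in setT) [set v | F i v]).
  exact: countable_bigcupT_measurable.
by apply/seteqP; split => v /= [i]; [exists i|move=> _ ?; exists i].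
Qed.

Lemma le_measure_cover (R : realType) (d : measure_display)
    (T : measurableType d) (mu : {measure set T -> \bar R}) (I : finType)
    (Q : pred I) (B A : set T) (F : I -> set T) :
  measurable B -> measurable A -> (forall i, measurable (F i)) ->
  (forall v, B v -> A v \/ exists2 i, Q i & F i v) ->
  (mu B <= mu A + \sum_(i | Q i) mu (F i))%E.
Proof.
move=> mB mA mF BAF.
have mU (r : seq I) : measurable (\big[setU/set0]_(i <- r | Q i) F i).
  by apply: bigsetU_measurable.
apply: (@le_trans _ _ (mu (A `|` \big[setU/set0]_(i | Q i) F i))).
  apply: le_measure; rewrite ?inE//; first exact: measurableU.
  move=> v /BAF[Av|[i Qi Fi]]; [by left|right].
  by rewrite (bigD1 i)//=; left.
apply: (@le_trans _ _ (mu A + mu (\big[setU/set0]_(i | Q i) F i))%E).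
  exact: measureU2.
rewrite leeD2l//; elim: (index_enum I) => [|i r IH].
  by rewrite !big_nil measure0.
rewrite !big_cons; case: ifP => // _.
apply: (@le_trans _ _ (mu (F i) + mu (\big[setU/set0]_(i <- r | Q i) F i))%E).
  exact: measureU2.
by rewrite leeD2l.
Qed.

Lemma measurable_layer_bad (R : realType) (d : measure_display)
    (T : measurableType d) (n M : nat) (c cap p N : R) (acc : bool)
    (x : nat -> signal n R) (b : bool) (j : nat) (w : T -> signal n R) :
  measurable_fun setT w ->
  measurable [set v | layer_bad M c cap p N acc x b j (w v)].
Proof.
move=> mw.
have mW : measurable_fun setT (fun v => sqnorm (w v)) by exact: measurable_sqnorm.
have my : measurable_fun setT (fun v => add_signal (sgn_signal b (x j)) (w v)).
  exact: measurable_add_signal.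
have mY := measurable_sqnorm my.
rewrite (_ : mkset _ = [set v | sqnorm (w v) <= n%:R * N] `&`
  ([set _ | n%:R * cap <= sqnorm (x j)] `|`
   [set v | sqnorm (w v) + n%:R * p <=
      sqnorm (add_signal (sgn_signal b (x j)) (w v))] `|`
   [set v | sqnorm (add_signal (sgn_signal b (x j)) (w v)) <=
      sqnorm (w v) + n%:R * c] `|`
   ([set _ | acc] `&` [set v | sqnorm (w v) + n%:R * c <=
      sqnorm (add_signal (sgn_signal b (x j)) (w v))] `&`
    [set v | exists k, exists b', ((k < M)%N /\ k != j) /\
      sqnorm (sub_signal (add_signal (sgn_signal b (x j)) (w v))
        (sgn_signal b' (x k))) <= sqnorm (w v)]))).
  have mc e : measurable_fun setT (fun v => sqnorm (w v) + e).
    exact: measurable_funD.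
  apply: measurableI; first exact: measurable_le_set.
  apply: measurableU; first apply: measurableU; first apply: measurableU.
  - exact: measurable_const_set.
  - exact: measurable_le_set.
  - exact: measurable_le_set.
  - apply: measurableI; first apply: measurableI.
    + exact: measurable_const_set.
    + exact: measurable_le_set.
    + apply: measurable_ex_set => k; apply: measurable_ex_set => b'.
      apply: measurableI; first exact: measurable_const_set.
      apply: measurable_le_set => //.
      by apply: measurable_sqnorm; apply: measurable_sub_signal.
apply/seteqP; split => v /=; rewrite /layer_bad /=.
- move=> [? [?|?|?|[? ? [k [? ? [b' ?]]]]]]; split => //.
  + by left; left; left.
  + by left; left; right.
  + by left; right.
  + by right; split => //; exists k, b'.
- move=> [? [[[?|?]|?]|[[? ?] [k [b' [[? ?] ?]]]]]]; split => //.
  + by constructor 1.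
  + by constructor 2.
  + by constructor 3.
  + by constructor 4; split => //; exists k; split => //; exists b'.
Qed.

(** Codewords and noise are read on separate copies of [Omega]. They are thus independent in the
    average even when both come from the same sequence, and fixing the codewords leaves a statement
    about the noise on [Omega]. *)
Lemma layer_codebook (R : realType) (d : measure_display)
    (Omega : measurableType d) (P : probability Omega R) (n M : nat)
    (E : finType) (G : Omega -> signal n R) (w : E -> Omega -> signal n R)
    (idx : E -> nat) (sg acc : pred E) (N : E -> R) (c cap p t s bd : R) :
  measurable_fun setT G -> (forall e, measurable_fun setT (w e)) ->
  (forall e, (idx e < M)%N) ->
  (P [set o | (n%:R * cap <= sqnorm (G o))%R] <= t%:E)%E ->
  (forall e b (u : signal n R), sqnorm u <= n%:R * N e ->
    (P [set o | (sqnorm u + n%:R * p <=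
       sqnorm (add_signal (sgn_signal b (G o)) u))%R] <= t%:E)%E) ->
  (forall e b (u : signal n R), sqnorm u <= n%:R * N e ->
    (P [set o | (sqnorm (add_signal (sgn_signal b (G o)) u) <=
       sqnorm u + n%:R * c)%R] <= t%:E)%E) ->
  (forall e b (y u : signal n R), acc e -> sqnorm u <= n%:R * N e ->
    sqnorm u + n%:R * c <= sqnorm y ->
    (P [set o | (sqnorm (sub_signal y (sgn_signal b (G o))) <=
       sqnorm u)%R] <= s%:E)%E) ->
  0 <= s -> #|E|%:R * (3 * t + M%:R * (2 * s)) < bd ->
  exists x : nat -> signal n R,
  (\sum_e P [set o | layer_bad M c cap p (N e) (acc e) x (sg e) (idx e) (w e o)]
   < bd%:E)%E.
Proof.
move=> mG mw idxM HT HA HB HC s0 Hbd.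
have t0 : 0 <= t by rewrite -lee_fin; apply: le_trans HT; exact: measure_ge0.
pose y e (z : Omega * Omega) := add_signal (sgn_signal (sg e) (G z.1)) (w e z.2).
have mw2 e (d' : measure_display) (T' : measurableType d') (f : T' -> Omega) :
    measurable_fun setT f -> measurable_fun setT (fun z => w e (f z)).
  by move=> mf; apply: (measurableT_comp (mw e) mf).
have mG2 (d' : measure_display) (T' : measurableType d') (f : T' -> Omega) :
    measurable_fun setT f -> measurable_fun setT (fun z => G (f z)).
  by move=> mf; apply: (measurableT_comp mG mf).
have mW e := measurable_sqnorm (mw2 e _ _ _ (@measurable_snd _ _ Omega Omega)).
have mX := measurable_sqnorm (mG2 _ _ _ (@measurable_fst _ _ Omega Omega)).
have my e : measurable_fun setT (y e).
  apply: measurable_add_signal; last exact: mw2.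
  by apply: measurable_sgn_signal; exact: mG2.
have mY e := measurable_sqnorm (my e).
(* [A] gathers the three alternatives that involve the sent word only, [A2] the comparison with one
   rival under either sign: whence 3 t and 2 s. *)
pose A e : set (Omega * Omega) := [set z | sqnorm (w e z.2) <= n%:R * N e] `&`
  ([set z | n%:R * cap <= sqnorm (G z.1)] `|`
   [set z | sqnorm (w e z.2) + n%:R * p <= sqnorm (y e z)] `|`
   [set z | sqnorm (y e z) <= sqnorm (w e z.2) + n%:R * c]).
pose A2 e : set (Omega * Omega * Omega) :=
  [set z | sqnorm (w e z.2) <= n%:R * N e] `&`
  ([set z | acc e] `&`
   [set z | sqnorm (w e z.2) + n%:R * c <= sqnorm (y e (z.1.1, z.2))] `&`
   ([set z | sqnorm (sub_signal (y e (z.1.1, z.2)) (sgn_signal false (G z.1.2)))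
     <= sqnorm (w e z.2)] `|`
    [set z | sqnorm (sub_signal (y e (z.1.1, z.2)) (sgn_signal true (G z.1.2)))
     <= sqnorm (w e z.2)])).
have mA e : measurable (A e).
  apply: measurableI; first exact: measurable_le_set.
  apply: measurableU; first apply: measurableU; apply: measurable_le_set => //;
    exact: measurable_funD.
have mA2 e : measurable (A2 e).
  have m11 : measurable_fun setT (fun z : Omega * Omega * Omega => z.1.1).
    exact: measurableT_comp.
  have m12 : measurable_fun setT (fun z : Omega * Omega * Omega => z.1.2).
    exact: measurableT_comp.
  have mp : measurable_fun setT
      (fun z : Omega * Omega * Omega => (z.1.1, z.2)).
    exact: measurable_fun_pair.
  have mz := measurable_sqnorm
    (mw2 e _ _ _ (@measurable_snd _ _ (Omega * Omega)%type Omega)).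
  have my2 := measurableT_comp (my e) mp.
  have mS b : measurable_fun setT (fun z : Omega * Omega * Omega =>
      sqnorm (sub_signal (y e (z.1.1, z.2)) (sgn_signal b (G z.1.2)))).
    apply: measurable_sqnorm; apply: measurable_sub_signal => //.
    by apply: measurable_sgn_signal; exact: mG2.
  apply: measurableI; first exact: measurable_le_set.
  apply: measurableI; first apply: measurableI.
  - exact: measurable_const_set.
  - apply: measurable_le_set; first exact: measurable_funD.
    exact: measurable_sqnorm.
  - by apply: measurableU; exact: measurable_le_set.
have mG1 b u : measurable_fun setT (fun o => sqnorm (add_signal (sgn_signal b (G o)) u)).
  by apply: measurable_sqnorm; apply: measurable_add_signal => //; exact: measurable_sgn_signal.
have PA e v : (P [set o | A e (o, v)] <= (3 * t)%:E)%E.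
  have [wN|wN] := boolP (sqnorm (w e v) <= n%:R * N e); last first.
    rewrite (_ : mkset _ = set0) ?measure0 ?lee_fin ?mulr_ge0//.
    by apply/seteqP; split => // o [/= H _]; move: wN; rewrite H.
  pose F (i : 'I_2) : set Omega := if i == ord0
    then [set o | sqnorm (w e v) + n%:R * p <=
       sqnorm (add_signal (sgn_signal (sg e) (G o)) (w e v))]
    else [set o | sqnorm (add_signal (sgn_signal (sg e) (G o)) (w e v)) <=
       sqnorm (w e v) + n%:R * c].
  apply: (@le_trans _ _ (P [set o | (n%:R * cap <= sqnorm (G o))%R] +
      \sum_(i | xpredT i) P (F i))%E).
    apply: le_measure_cover.
    - have mAv : measurable_fun setT (fun o : Omega => (o, v)).
        exact: measurable_pair2.
      by have := mAv measurableT _ (mA e); rewrite setTI.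
    - by apply: measurable_le_set => //; exact: measurable_sqnorm.
    - by move=> i; rewrite /F; case: ifP => _; exact: measurable_le_set.
    - move=> o [_ [[?|?]|?]]; [by left|right..].
      + by exists ord0.
      + by exists (lift ord0 ord0).
  rewrite big_ord_recl big_ord1 /F/=.
  rewrite (_ : (3 * t)%:E = (t%:E + (t%:E + t%:E))%E); last first.
    by rewrite -!EFinD; congr EFin; ring.
  apply: leeD => //; apply: leeD; [exact: (HA e)|exact: (HB e)].
have PA2 e o v : (P [set o' | A2 e (o, o', v)] <= (2 * s)%:E)%E.
  have s20 : 0 <= 2 * s by rewrite mulr_ge0.
  have [/and3P[wN ae yc]|H] := boolP [&& sqnorm (w e v) <= n%:R * N e, acc e &
      sqnorm (w e v) + n%:R * c <= sqnorm (y e (o, v))]; last first.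
    rewrite (_ : mkset _ = set0) ?measure0 ?lee_fin//.
    by apply/seteqP; split => // o' [/= ? [[? ?] _]]; move/negP: H; apply; apply/and3P.
  have mS b : measurable_fun setT (fun o' =>
      sqnorm (sub_signal (y e (o, v)) (sgn_signal b (G o')))).
    apply: measurable_sqnorm; apply: measurable_sub_signal => //.
    exact: measurable_sgn_signal.
  pose F b : set Omega :=
    [set o' | sqnorm (sub_signal (y e (o, v)) (sgn_signal b (G o'))) <= sqnorm (w e v)].
  apply: (@le_trans _ _ (P set0 + \sum_(b | xpredT b) P (F b))%E).
    apply: le_measure_cover => //.
    - have mAv : measurable_fun setT (fun o' : Omega => (o, o', v)).
        by apply: measurable_fun_pair => //; exact: measurable_fun_pair.
      by have := mAv measurableT _ (mA2 e); rewrite setTI.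
    - by move=> b; exact: measurable_le_set.
    - by move=> o' [_ [_ [?|?]]]; right; [exists false|exists true].
  rewrite measure0 add0e big_bool /F/=.
  rewrite (_ : (2 * s)%:E = (s%:E + s%:E)%E); last first.
    by rewrite -!EFinD; congr EFin; ring.
  by apply: leeD; exact: HC ae wN yc.
have s20 : 0 <= 2 * s by rewrite mulr_ge0.
have [x Hx] := random_codebook P idxM mA mA2 PA PA2 s20 Hbd.
exists (G \o x); apply: le_lt_trans Hx; apply: lee_sum => e _.
have mAx : measurable [set v | A e (x (idx e), v)].
  have mAv : measurable_fun setT (fun v : Omega => (x (idx e), v)).
    exact: measurable_pair1.
  by have := mAv measurableT _ (mA e); rewrite setTI.
have mA2x k : measurable [set v | A2 e (x (idx e), x k, v)].
  have mAv : measurable_fun setT (fun v : Omega => (x (idx e), x k, v)).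
    by apply: measurable_fun_pair => //; exact: measurable_fun_pair.
  by have := mAv measurableT _ (mA2 e); rewrite setTI.
apply: le_measure_cover => //.
  by apply: measurable_layer_bad; exact: mw.
move=> v [wN []].
- by move=> ?; left; split => //; left; left.
- by move=> ?; left; split => //; left; right.
- by move=> ?; left; split => //; right.
- move=> [ae yc [k [kM kj [b kb]]]]; right; exists (Ordinal kM) => //=.
  by split => //; split => //; case: b kb; [right|left].
Qed.

Lemma measurable_all_set (d : measure_display) (T : measurableType d)
    (I : countType) (F : I -> T -> Prop) :
  (forall i, measurable [set v | F i v]) ->
  measurable [set v | forall i, F i v].
Proof.
move=> mF; rewrite (_ : mkset _ = ~` [set v | exists i, ~ F i v]).
  by apply: measurableC; apply: measurable_ex_set => i; apply: measurableC; exact: mF.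
by apply/seteqP; split => v /= => [H [i]|H i]; [exact|apply: contrapT => ?; apply: H; exists i].
Qed.

(** * Layered codes *)

(** A minimiser always exists, so the default [k0] is never returned. Ties are broken by a rule that
    sees only the set of minimisers. *)
Definition nn_decoder {R : realType} {n m : nat} (k0 : 'I_m)
    (e : 'I_m -> signal n R) (y : signal n R) : 'I_m :=
  odflt k0 [pick k in [set k | [forall k', sqnorm (sub_signal y (e k)) <=
                                           sqnorm (sub_signal y (e k'))]]%SET].

Lemma nn_decoderP (R : realType) (n m : nat) (k0 : 'I_m)
    (e : 'I_m -> signal n R) (y : signal n R) (k : 'I_m) :
  sqnorm (sub_signal y (e (nn_decoder k0 e y))) <= sqnorm (sub_signal y (e k)).
Proof.
rewrite /nn_decoder; case: pickP => [k1|H]; first by rewrite inE => /forallP.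
have [k1 _ k1P] := @Order.TotalTheory.arg_minP _ _ _ k0 xpredT
  (fun k => sqnorm (sub_signal y (e k))) isT.
by have := H k1; rewrite inE => /forallP[]; move=> k'; exact: k1P.
Qed.

Lemma measurable_nn_decoder (R : realType) (n m : nat) (k0 : 'I_m)
    (e : 'I_m -> signal n R) (k : 'I_m) :
  measurable (nn_decoder k0 e @^-1` [set k]).
Proof.
have md k' : measurable_fun setT
    (fun y : signal n R => sqnorm (sub_signal y (e k'))).
  by apply: measurable_sqnorm; exact: measurable_sub_signal.
pose S (y : signal n R) := [set k | [forall k', sqnorm (sub_signal y (e k)) <=
  sqnorm (sub_signal y (e k'))]]%SET.
have mS k' : measurable [set y | k' \in S y].
  rewrite (_ : mkset _ = [set y | forall k'', sqnorm (sub_signal y (e k')) <=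
      sqnorm (sub_signal y (e k''))]).
    by apply: measurable_all_set => k''; exact: measurable_le_set.
  by apply/seteqP; split => y; rewrite /= inE => /forallP.
(* The decision depends on [y] only through its set of minimisers, which takes finitely many values
   [A]. *)
rewrite (_ : _ @^-1` _ = [set y | exists A : {set 'I_m},
    (odflt k0 [pick k in A] = k) /\ forall k', (k' \in S y) = (k' \in A)]).
  apply: measurable_ex_set => A; apply: measurableI.
    exact: measurable_const_set.
  apply: measurable_all_set => k'; case: (k' \in A); first exact: mS.
  rewrite (_ : mkset _ = ~` [set y | k' \in S y]); first by apply: measurableC; exact: mS.
  by apply/seteqP; split => y /= => [->|/negP/negbTE].
apply/seteqP; split => y /=; first by move=> yk; exists (S y).
by move=> [A [Ak /setP SA]]; rewrite -Ak -SA.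
Qed.

Lemma gaussian_likelihoodE (R : realType) (n : nat) (v : R)
    (x y : signal n R) : 0 < v ->
  gaussian_likelihood v x y = normal_peak (Num.sqrt v) ^+ n *
    expR (- sqnorm (sub_signal y x) / (v *+ 2)).
Proof.
move=> v0; rewrite /gaussian_likelihood.
under eq_bigr do rewrite normal_pdfE ?gt_eqF ?sqrtr_gt0//.
rewrite big_split/= prodr_const card_ord; congr (_ * _).
rewrite /normal_fun -expR_sum; congr expR.
rewrite /sqnorm -sumrN mulr_suml; apply: eq_bigr => t _.
by rewrite tnth_mktuple sqr_sqrtr ?ltW.
Qed.

(** The likelihood is a decreasing function of the distance for every variance, so the same decoder
    suits receivers of different noise levels. *)
Lemma nearest_maximizes_likelihood (R : realType) (n : nat) (v : R)
    (x x' y : signal n R) : 0 < v ->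
  sqnorm (sub_signal y x') <= sqnorm (sub_signal y x) ->
  gaussian_likelihood v x y <= gaussian_likelihood v x' y.
Proof.
move=> v0 H; rewrite !gaussian_likelihoodE// ler_wpM2l//.
  by rewrite exprn_ge0// normal_peak_ge0.
by rewrite ler_expR ler_pM2r ?lerN2// invr_gt0 mulrn_wgt0.
Qed.

Definition map_messages {R : realType} {n N K : nat} (c : layered_code R n N K)
    (f : forall l, 'I_(msize c l) -> 'I_(msize c l)) (m : messages c) :
  messages c := [ffun l => f l (m l)].

Lemma map_messages_inj (R : realType) (n N K : nat) (c : layered_code R n N K)
    (f : forall l, 'I_(msize c l) -> 'I_(msize c l)) :
  (forall l, injective (f l)) -> injective (map_messages f).
Proof.
move=> fI m m' /ffunP H; apply/ffunP => l.
by have := H l; rewrite !ffunE => /fI.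
Qed.

(** Coordinate [l] of a uniform message is uniform: exchanging two values there, by the
    transposition [tau] transported along the dependent type, permutes the messages. *)
Lemma sum_message_marginal (R : realType) (n N K : nat)
    (c : layered_code R n N K) (l : 'I_N) (f : 'I_(msize c l) -> R) :
  (\sum_(m : messages c) f (m l)) * (msize c l)%:R =
  #|messages c|%:R * \sum_v f v.
Proof.
pose cnt v : R := \sum_(m : messages c | m l == v) 1.
have cntE v v' : cnt v = cnt v'.
  pose tau j : 'I_(msize c j) -> 'I_(msize c j) :=
    match eqVneq j l with
    | EqNotNeq e => fun x => ecast k ('I_(msize c k)) (esym e)
        (tperm v v' (ecast k ('I_(msize c k)) e x))
    | NeqNotEq _ => id
    end.
  have tauI j : injective (tau j).
    rewrite /tau; case: (eqVneq j l) => [e|_] //.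
    by move: v v' @tau; case: _ / e => v v' x y; exact: perm_inj.
  have taul x : tau l x = tperm v v' x.
    rewrite /tau; case: (eqVneq l l) => [e|/eqP//].
    by rewrite (eq_irrelevance e erefl).
  rewrite /cnt (reindex_inj (map_messages_inj tauI))/=.
  by apply: eq_bigl => m; rewrite ffunE taul (inv_eq (tpermK v v')) tpermL.
have sumE : \sum_(m : messages c) f (m l) = \sum_v f v * cnt v.
  rewrite (partition_big (fun m : messages c => m l) xpredT)//=.
  apply: eq_bigr => v _; rewrite /cnt mulr_sumr.
  by apply: eq_bigr => m /eqP ->; rewrite mulr1.
pose v0 : 'I_(msize c l) := Ordinal (msize_gt0 c l).
have cardE : #|messages c|%:R = (msize c l)%:R * cnt v0.
  rewrite -sum1_card natr_sum (partition_big (fun m : messages c => m l) xpredT)//=.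
  rewrite (eq_bigr (fun _ => cnt v0)); last by move=> v _; exact: cntE.
  by rewrite sumr_const card_ord mulr_natl.
rewrite sumE cardE (eq_bigr (fun v => cnt v0 * f v)); last first.
  by move=> v _; rewrite (cntE v v0) mulrC.
by rewrite -mulr_sumr; ring.
Qed.

(** Cross terms vanish: flipping the sign in one layer alone permutes the messages and negates the
    sum of the products. *)
Lemma transmitted_power (R : realType) (n N K : nat) (c : layered_code R n N K)
    (flip : forall l, 'I_(msize c l) -> 'I_(msize c l)) :
  (0 < n)%N -> (forall l, injective (flip l)) ->
  (forall l v, enc (flip l v) = opp_signal (enc v)) ->
  average_power (transmitted (c := c)) = \sum_l average_power (@enc _ _ _ _ c l).
Proof.
move=> n0 flipI flipE.
pose X l t (m : messages c) := tnth (enc (m l)) t.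
have cross k l t : k != l -> \sum_m X k t m * X l t m = 0.
  move=> kl; pose f j := if j == l then flip j else id.
  have fI j : injective (f j) by rewrite /f; case: (j == l) => // ? ?; exact: flipI.
  have : \sum_m X k t m * X l t m = - \sum_m X k t m * X l t m.
    rewrite {1}(reindex_inj (map_messages_inj fI))/= -sumrN.
    apply: eq_bigr => m _; rewrite /X !ffunE /f (negbTE kl) eqxx flipE.
    by rewrite tnth_mktuple mulrN.
  lra.
have sqE t : \sum_(m : messages c) tnth (transmitted m) t ^+ 2 =
    \sum_l \sum_m X l t m ^+ 2.
  transitivity (\sum_m \sum_k \sum_l X k t m * X l t m).
    apply: eq_bigr => m _; rewrite tnth_mktuple expr2 mulr_suml.
    by apply: eq_bigr => k _; rewrite mulr_sumr.
  rewrite exchange_big/=; apply: eq_bigr => k _.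
  rewrite exchange_big/= (bigD1 k)//= [X in _ + X]big1 ?addr0.
    by apply: eq_bigr => m _; rewrite expr2.
  by move=> l lk; rewrite cross// eq_sym.
have msg0 : #|messages c|%:R != 0 :> R.
  rewrite pnatr_eq0 -lt0n; apply/card_gt0P.
  by exists [ffun l => Ordinal (msize_gt0 c l)].
have nn0 : n%:R != 0 :> R by rewrite pnatr_eq0 -lt0n.
rewrite /average_power exchange_big/=; under eq_bigr do rewrite sqE.
rewrite exchange_big/= mulr_suml; apply: eq_bigr => l _.
have M0 : (msize c l)%:R != 0 :> R by rewrite pnatr_eq0 -lt0n msize_gt0.
have := sum_message_marginal (fun v => \sum_t tnth (enc v) t ^+ 2).
rewrite exchange_big/= card_ord => H.
apply: (mulIf M0); rewrite mulrAC H.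
by field; rewrite nn0 M0 msg0.
Qed.

Lemma filter_enum_ord (N a : nat) (aN : (a < N)%N) :
  [seq k : 'I_N <- enum 'I_N | (a <= k)%N] =
  Ordinal aN :: [seq k : 'I_N <- enum 'I_N | (a < k)%N].
Proof.
apply: (inj_map val_inj); rewrite /= -!(filter_map val) val_enum_ord.
have -> : iota 0 N = iota 0 a ++ a :: iota a.+1 (N - a.+1).
  by rewrite -{1}(subnKC aN) addSnnS iotaD.
rewrite !filter_cat /= leqnn ltnn.
rewrite !(eq_in_filter (s := iota 0 a) (a2 := pred0)); last 2 first.
- by move=> k; rewrite mem_iota/= => ka; rewrite ltnNge ltnW.
- by move=> k; rewrite mem_iota/= => ka; rewrite leqNgt ka.
rewrite !filter_pred0 /= !(eq_in_filter (s := iota a.+1 _) (a2 := predT))//.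
- by move=> k; rewrite mem_iota => /andP[].
- by move=> k; rewrite mem_iota => /andP[/ltnW].
Qed.

(* The signal left once the sub-channels numbered [a] and above have been
   removed from the output for the message [m] and the noise [z]. *)
Definition partial_signal {R : realType} {n N K : nat} (c : layered_code R n N K)
    (m : messages c) (z : signal n R) (a : nat) : signal n R :=
  [tuple \sum_(k < N | (k < a)%N) tnth (enc (m k)) t + tnth z t | t < n].

(** The usual genie argument: it suffices that each decoder above [l] be right when fed the correct
    residual, for then no error ever propagates. *)
Lemma residual_correct (R : realType) (n N K : nat) (c : layered_code R n N K)
    (m : messages c) (z : signal n R) (i : 'I_K) (l : 'I_N) :
  (forall k : 'I_N, (l < k)%N -> dec c i k (partial_signal m z k.+1) = m k) ->
  residual c i l (add_signal (transmitted m) z) = partial_signal m z l.+1.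
Proof.
move=> Hk; have lN := ltn_ord l.
(* [d] counts the sub-channels already removed from the top. *)
have H d : (d <= N - l.+1)%N ->
    foldl (fun r k => sub_signal r (enc (dec c i k r)))
      (add_signal (transmitted m) z)
      (rev [seq k : 'I_N <- enum 'I_N | (N - d <= k)%N]) =
    partial_signal m z (N - d).
  elim: d => [_|d IH dN].
    rewrite subn0 (eq_filter (a2 := pred0)); last first.
      by move=> k /=; rewrite leqNgt ltn_ord.
    rewrite filter_pred0/=; apply: eq_from_tnth => t; rewrite !tnth_mktuple.
    by congr (_ + _); apply: eq_bigl => k; rewrite ltn_ord.
  have bN : (N - d.+1 < N)%N by rewrite ltn_subrL/= (leq_ltn_trans _ lN).
  have bS : (N - d.+1).+1 = (N - d)%N.
    by rewrite -subSn// (leq_trans dN)// leq_subr.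
  rewrite (filter_enum_ord bN) rev_cons foldl_rcons.
  rewrite (eq_filter (a2 := fun k : 'I_N => (N - d <= k)%N)); last first.
    by move=> k; rewrite -bS.
  rewrite IH ?(ltnW dN)// -bS.
  have -> : dec c i (Ordinal bN) (partial_signal m z (N - d.+1).+1) = m (Ordinal bN).
    by apply: Hk; rewrite /= -ltnS bS ltn_subRL -ltn_subRL; lia.
  apply: eq_from_tnth => t; rewrite !tnth_mktuple/= (bigD1 (Ordinal bN))//=.
  rewrite (eq_bigl (fun k : 'I_N => (k < N - d.+1)%N)); first by ring.
  by move=> k; rewrite -val_eqE/= ltnS leq_eqVlt; case: ltngtP.
rewrite /residual -[in RHS](subKn lN) -H//; congr foldl; congr rev.
by apply: eq_filter => k; rewrite subKn.
Qed.

Lemma measurable_coding (R : realType) (d : measure_display)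
    (T : measurableType d) (n m : nat) (D : signal n R -> 'I_m)
    (e : 'I_m -> signal n R) (f : T -> signal n R) :
  (forall k, measurable (D @^-1` [set k])) -> measurable_fun setT f ->
  measurable_fun setT (fun v => e (D (f v))).
Proof.
move=> mD mf; apply/measurable_fun_tnthP => t _ Y mY; rewrite setTI.
rewrite (_ : _ @^-1` _ =
    [set v | exists k, D (f v) = k /\ Y (tnth (e k) t)]); last first.
  apply/seteqP; split => v /=; first by move=> Yv; exists (D (f v)).
  by move=> [k [<-]].
apply: measurable_ex_set => k; apply: measurableI.
  by have := mf measurableT _ (mD k); rewrite setTI.
exact: measurable_const_set.
Qed.

Lemma measurable_error (R : realType) (n N K : nat) (c : layered_code R n N K)
    (d : measure_display) (T : measurableType d) (f : T -> signal n R)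
    (i : 'I_K) (l : 'I_N) (k : 'I_(msize c l)) :
  measurable_fun setT f ->
  measurable [set v | successive_estimate c i l (f v) != k].
Proof.
move=> mf; have mr : measurable_fun setT (fun v => residual c i l (f v)).
  rewrite /residual; elim: (rev _) f mf => [|k' s IH] f mf //=.
  apply: (IH (fun v => sub_signal (f v) (enc (dec c i k' (f v))))).
  apply: measurable_sub_signal => //; apply: measurable_coding => //.
  exact: measurable_dec.
rewrite (_ : mkset _ = ~` ((fun v => residual c i l (f v)) @^-1`
    (dec c i l @^-1` [set k]))).
  apply: measurableC; have := mr measurableT _ (measurable_dec i k).
  by rewrite setTI.
by apply/seteqP; split => v /= /eqP.
Qed.

(** * Codes assembled from one codebook per layer *)

Lemma book_size_gt0 (N M : nat) : forall l : 'I_N, (0 < #|book_index M|)%N.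
Proof. by move=> l; rewrite card_book_index. Qed.

Definition book_enc {R : realType} {n M : nat} (p cap : R)
    (x : nat -> signal n R) (k : 'I_#|book_index M|) : signal n R :=
  book_word p cap x (enum_val k).

Definition book_default (M : nat) : 'I_#|book_index M| :=
  enum_rank ((false, None) : book_index M).

Definition book_code {R : realType} {n N K : nat} (M : nat) (p cap : nat -> R)
    (X : nat -> nat -> signal n R) : layered_code R n N K :=
  @LayeredCode R n N K (fun=> #|book_index M|) (book_size_gt0 M)
    (fun l => book_enc (p l) (cap l) (X l))
    (fun i l => nn_decoder (book_default M) (book_enc (p l) (cap l) (X l)))
    (fun i l => measurable_nn_decoder (book_default M)
                  (book_enc (p l) (cap l) (X l))).

Definition noise_word {R : realType} {d : measure_display}
    {Omega : measurableType d} {P : probability Omega R} (n : nat)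
    (Z : nat -> {RV P >-> R}) (o : Omega) : signal n R :=
  [tuple Z t o | t < n].

Lemma noise_wordE (R : realType) (d : measure_display)
    (Omega : measurableType d) (P : probability Omega R) (n : nat)
    (Z : nat -> {RV P >-> R}) : noise_word n Z = gauss_word n 1 Z.
Proof.
by apply/funext => o; apply: eq_from_tnth => t; rewrite !tnth_mktuple mul1r.
Qed.

(* The garbage codeword [None] is given an arbitrary index: it is sent too
   rarely to matter. *)
Definition book_pos {M : nat} (v : book_index M) : nat :=
  if v.2 is Some j then j : nat else 0%N.

(** Convertible to the messages of [book_code], but free of the codewords: sums over messages can be
    written before the codebooks are chosen. *)
Definition book_messages (N M : nat) : finType :=
  {dffun forall _ : 'I_N, 'I_#|book_index M|}.

Definition book_bad {R : realType} {n N M : nat} (K : nat) (p cap c : nat -> R)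
    (X : nat -> nat -> signal n R) (m : book_messages N M) (Nz : nat -> R)
    (acc : 'I_N -> bool) (l : 'I_N) (z : signal n R) : Prop :=
  layer_bad M (c l) (cap l) (p l) (Nz l) (acc l) (X l) (enum_val (m l)).1
    (book_pos (enum_val (m l)))
    (partial_signal (c := book_code (K := K) M p cap X) m z l).

Lemma measurable_partial_signal (R : realType) (n N K : nat)
    (c : layered_code R n N K) (d : measure_display) (T : measurableType d)
    (m : messages c) (z : T -> signal n R) (a : nat) :
  measurable_fun setT z -> measurable_fun setT (fun v => partial_signal m (z v) a).
Proof.
move=> mz; apply/measurable_fun_tnthP => t.
rewrite (_ : _ \o _ = fun v => \sum_(k < N | (k < a)%N) tnth (enc (m k)) t +
    tnth (z v) t).
  by apply: measurable_funD => //; exact: (measurable_fun_tnthP _).1.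
by apply/funext => v /=; rewrite tnth_mktuple.
Qed.

(** Induction on the layers from the bottom. The interference of a layer is determined by the
    codebooks already fixed, and [step] accepts any interference, so nothing about those codebooks
    has to be remembered. *)
Lemma choose_books (R : realType) (d : measure_display)
    (Omega : measurableType d) (P : probability Omega R) (n N K M : nat)
    (Z : 'I_K -> nat -> {RV P >-> R}) (p cap c : nat -> R)
    (Nz : 'I_K -> nat -> R) (acc : 'I_K -> 'I_N -> bool) (eps : R) :
  (0 < M)%N ->
  (forall (l : 'I_N) (E : finType) (w : E -> Omega -> signal n R)
      (idx : E -> nat) (sg : pred E) (rc : E -> 'I_K),
    (0 < #|E|)%N -> (forall e, measurable_fun setT (w e)) ->
    (forall e, (idx e < M)%N) ->
    exists x : nat -> signal n R,
    (\sum_e P [set o | layer_bad M (c l) (cap l) (p l) (Nz (rc e) l)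
        (acc (rc e) l) x (sg e) (idx e) (w e o)] < (#|E|%:R * eps)%:E)%E) ->
  (0 < K)%N ->
  exists X : nat -> nat -> signal n R, forall l : 'I_N,
  (\sum_(e : 'I_K * book_messages N M)
     P [set o | book_bad K p cap c X e.2 (Nz e.1) (acc e.1) l
                  (noise_word n (Z e.1) o)] <
   (#|{: 'I_K * book_messages N M}|%:R * eps)%:E)%E.
Proof.
move=> M0 step K0.
have E0 : (0 < #|{: 'I_K * book_messages N M}|)%N.
  apply/card_gt0P; exists (Ordinal K0, [ffun=> book_default M]).
  by rewrite inE.
suff H L : (L <= N)%N -> exists X : nat -> nat -> signal n R,
    forall l : 'I_N, (l < L)%N ->
    (\sum_(e : 'I_K * book_messages N M)
     P [set o | book_bad K p cap c X e.2 (Nz e.1) (acc e.1) l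
                  (noise_word n (Z e.1) o)] <
     (#|{: 'I_K * book_messages N M}|%:R * eps)%:E)%E.
  by have [X HX] := H N (leqnn _); exists X => l; exact: HX.
elim: L => [_|L IH LN]; first by exists (fun _ _ => zero_signal).
have [X HX] := IH (ltnW LN).
pose w (e : 'I_K * book_messages N M) o :=
  partial_signal (c := book_code (K := K) M p cap X) e.2 (noise_word n (Z e.1) o) L.
have mw e : measurable_fun setT (w e).
  apply: measurable_partial_signal; rewrite noise_wordE.
  exact: measurable_gauss_word.
have idxM (e : 'I_K * book_messages N M) :
    (book_pos (enum_val (e.2 (Ordinal LN))) < M)%N.
  by rewrite /book_pos; case: (enum_val _).2.
have [x Hx] := step (Ordinal LN) _ w _
  (fun e => (enum_val (e.2 (Ordinal LN))).1) (fun e => e.1) E0 mw idxM.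
pose X' k := if k == L then x else X k.
(* Inserting the codebook of layer [L] changes neither the interference seen by [L] nor the events
   of the lower layers. *)
have partialE (m : book_messages N M) z a : (a <= L)%N ->
    partial_signal (c := book_code (K := K) M p cap X') m z a =
    partial_signal (c := book_code (K := K) M p cap X) m z a.
  move=> aL; apply: eq_from_tnth => t; rewrite !tnth_mktuple; congr (_ + _).
  apply: eq_bigr => k ka; rewrite /= /book_enc /X' ifF//.
  by rewrite ltn_eqF// (leq_trans ka).
exists X' => l; rewrite ltnS leq_eqVlt => /predU1P[lL|lL].
  have -> : l = Ordinal LN by exact: val_inj.
  move: Hx; rewrite /book_bad /= => Hx; rewrite {1}/X' eqxx.
  under eq_bigr do under eq_set do rewrite partialE//.
  exact: Hx.
rewrite /book_bad {1}/X' ltn_eqF//.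
under eq_bigr do under eq_set do rewrite partialE 1?ltnW//.
exact: HX.
Qed.

Lemma add_signalK (R : realType) (n : nat) (x y : signal n R) :
  sub_signal (add_signal x y) x = y.
Proof.
by apply: eq_from_tnth => t; rewrite !tnth_mktuple addrC addKr.
Qed.

Lemma partial_signal0 (R : realType) (n N K : nat) (c : layered_code R n N K)
    (m : messages c) (z : signal n R) : partial_signal m z 0 = z.
Proof.
by apply: eq_from_tnth => t; rewrite tnth_mktuple big_pred0 ?add0r.
Qed.

Lemma partial_signalS (R : realType) (n N K : nat) (c : layered_code R n N K)
    (m : messages c) (z : signal n R) (l : 'I_N) :
  partial_signal m z l.+1 = add_signal (enc (m l)) (partial_signal m z l).
Proof.
apply: eq_from_tnth => t; rewrite !tnth_mktuple (bigD1 l)//= -addrA.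
congr (_ + (_ + _)); apply: eq_bigl => k.
by rewrite -val_eqE/= ltnS leq_eqVlt; case: ltngtP.
Qed.

(** Two inductions in opposite directions. Norms are bounded from the bottom ([normP]), which is why
    no layer may be bad, not even one below [l]; decoding proceeds from the top through
    [residual_correct]. *)
Lemma book_decoding_correct (R : realType) (n N K M : nat) (p cap c : nat -> R)
    (X : nat -> nat -> signal n R) (m : book_messages N M) (Nz : nat -> R)
    (acc : 'I_N -> bool) (z : signal n R) (i : 'I_K) (l : 'I_N) :
  (0 < n)%N ->
  (forall k : 'I_N, [/\ 0 <= c k, 0 <= cap k & cap k < p k]) ->
  (forall k : 'I_N, Nz k + p k <= Nz k.+1) ->
  (forall k : 'I_N, 4 * (Nz k + p k) < M%:R * (p k - cap k)) ->
  (forall k : 'I_N, (l <= k)%N -> acc k) ->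
  (forall k : 'I_N, (enum_val (m k)).2 != None) ->
  sqnorm z <= n%:R * Nz 0%N ->
  (forall k : 'I_N, ~ book_bad K p cap c X m Nz acc k z) ->
  successive_estimate (book_code (K := K) M p cap X) i l
    (add_signal (transmitted (c := book_code (K := K) M p cap X) m) z) = m l.
Proof.
move=> n0 cap0 NzS Mbig accl mS z0 nbad.
pose C : layered_code R n N K := book_code M p cap X.
have mE (k : 'I_N) : {j : 'I_M | enum_val (m k) = ((enum_val (m k)).1, Some j)}.
  have := mS k; case: (enum_val (m k)) => b [j|]//= _; by exists j.
have encE (k : 'I_N) : enc (l := k) (m k : 'I_(msize C k)) =
    book_word (p k) (cap k) (X k) (enum_val (m k)) by [].
have normP (k : nat) : (k <= N)%N ->
    sqnorm (partial_signal (c := C) m z k) <= n%:R * Nz k.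
  elim: k => [_|k IH kN]; first by rewrite partial_signal0.
  have wN := IH (ltnW kN).
  pose ok := Ordinal kN; have [j jE] := mE ok; have [c0 _ _] := cap0 ok.
  rewrite -[k.+1]/((ok : nat).+1) partial_signalS encE.
  have := nbad ok; rewrite /book_bad jE /book_pos/= => nb.
  have [_ H _] := not_layer_bad c0 wN nb.
  by rewrite (le_trans H)// ler_wpM2l//; exact: (NzS ok).
have decE (k : 'I_N) : (l <= k)%N ->
    dec C i k (partial_signal (c := C) m z k.+1) = m k.
  move=> lk; rewrite partial_signalS encE.
  set w := partial_signal _ _ k; have [j jE] := mE k.
  have wN : sqnorm w <= n%:R * Nz k by apply: normP; exact: ltnW.
  have [c0 cp0 cpp] := cap0 k.
  have := nbad k; rewrite /book_bad accl// -/C -/w jE /book_pos/= => nb.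
  apply: contrapT => /eqP neq.
  set y := add_signal _ w in neq *.
  have vneq : enum_val (dec C i k y) != ((enum_val (m k)).1, Some j).
    by rewrite -jE (inj_eq enum_val_inj).
  have := book_separation n0 c0 cp0 cpp (Mbig k) wN nb vneq.
  rewrite ltNge => /negP; apply.
  have near := nn_decoderP (book_default M) (book_enc (p k) (cap k) (X k)) y (m k).
  have yE : sqnorm (sub_signal y (book_enc (p k) (cap k) (X k) (m k))) = sqnorm w.
    by rewrite /y -jE; exact: (congr1 sqnorm (add_signalK _ w)).
  by rewrite yE in near; exact: near.
rewrite /successive_estimate (residual_correct (c := C)); first exact: decE.
by move=> k lk; apply: decE; exact: ltnW.
Qed.

Lemma book_average_power (R : realType) (n N K M : nat) (p cap : nat -> R)
    (X : nat -> nat -> signal n R) (l : 'I_N) :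
  (0 < n)%N -> 0 <= cap l -> cap l <= p l ->
  average_power (@enc _ _ _ _ (book_code (K := K) M p cap X) l) = p l.
Proof.
move=> n0 cap0 capp; rewrite /average_power card_ord.
have := book_power M (X l) n0 cap0 capp.
rewrite (@big_enum_val _ _ _ (book_index M) predT (fun v => sqnorm _))/=.
rewrite /sqnorm => ->.
have n1 : n%:R != 0 :> R by rewrite pnatr_eq0 -lt0n.
have M1 : #|book_index M|%:R != 0 :> R by rewrite card_book_index pnatr_eq0.
by field; rewrite n1 M1.
Qed.

Lemma book_transmitted_power (R : realType) (n N K M : nat) (p cap : nat -> R)
    (X : nat -> nat -> signal n R) :
  (0 < n)%N -> (forall l : 'I_N, 0 <= cap l) -> (forall l : 'I_N, cap l <= p l) ->
  average_power (transmitted (c := book_code (N := N) (K := K) M p cap X)) =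
  \sum_(l < N) p l.
Proof.
move=> n0 cap0 capp.
pose flip (k : 'I_#|book_index M|) : 'I_#|book_index M| :=
  enum_rank ((~~ (enum_val k).1, (enum_val k).2) : book_index M).
have flipI : injective flip.
  apply: (can_inj (g := flip)) => k.
  rewrite /flip enum_rankK /= negbK; case E : (enum_val k) => [b o] /=.
  by rewrite -E enum_valK.
rewrite (@transmitted_power _ _ _ _ (book_code M p cap X) (fun=> flip))//.
  by apply: eq_bigr => l _; exact: book_average_power.
by move=> l v; rewrite /= /book_enc /flip enum_rankK book_word_neg.
Qed.

(** Three causes of error: some layer sends a [None] word (2 words out of 2 (M + 1) in each of [N]
    layers), the noise is too strong ([th]), or some layer is bad. The factor K appears because a
    bound on the sum over all receivers is applied to one of them. *)
Lemma book_error_bound (R : realType) (d : measure_display)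
    (Omega : measurableType d) (P : probability Omega R) (n N K M : nat)
    (Z : 'I_K -> nat -> {RV P >-> R}) (p cap c : nat -> R)
    (Nz : 'I_K -> nat -> R) (acc : 'I_K -> 'I_N -> bool) (eps th : R)
    (X : nat -> nat -> signal n R) (i : 'I_K) (l : 'I_N) :
  (0 < n)%N ->
  (forall k : 'I_N, [/\ 0 <= c k, 0 <= cap k & cap k < p k]) ->
  (forall k : 'I_N, Nz i k + p k <= Nz i k.+1) ->
  (forall k : 'I_N, 4 * (Nz i k + p k) < M%:R * (p k - cap k)) ->
  (forall k : 'I_N, (l <= k)%N -> acc i k) ->
  (forall l : 'I_N, (\sum_(e : 'I_K * book_messages N M)
     P [set o | book_bad K p cap c X e.2 (Nz e.1) (acc e.1) l
                  (noise_word n (Z e.1) o)] <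
     (#|{: 'I_K * book_messages N M}|%:R * eps)%:E)%E) ->
  (P [set o | (n%:R * Nz i 0%N <= sqnorm (noise_word n (Z i) o))%R] <= th%:E)%E ->
  error_probability (book_code M p cap X) (Z i) i l <=
  N%:R / M.+1%:R + th + N%:R * (K%:R * eps).
Proof.
move=> n0 cap0 NzS Mbig accl Xbad thP.
pose C : layered_code R n N K := book_code M p cap X.
pose err (m : messages C) := [set w | successive_estimate C i l
  (add_signal (transmitted m) [tuple Z i t w | t < n]) != m l].
pose bad (m : messages C) (k : 'I_N) := [set o | book_bad K p cap c X m (Nz i) (acc i) k
                  (noise_word n (Z i) o)].
pose g (v : 'I_#|book_index M|) : R := if (enum_val v).2 == None then 1 else 0.
have mN : measurable_fun setT (noise_word n (Z i)).
  by rewrite noise_wordE; exact: measurable_gauss_word.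
have merr m : measurable (err m).
  apply: measurable_error; apply: measurable_add_signal => //.
have mbad m k : measurable (bad m k).
  by apply: measurable_layer_bad; exact: measurable_partial_signal.
have th0 : 0 <= th by rewrite -lee_fin; apply: le_trans thP; exact: measure_ge0.
have errP m : (P (err m) <= (\sum_k g (m k) + th)%:E + \sum_k P (bad m k))%E.
  have [/forallP mS|] := boolP [forall k, (enum_val (m k)).2 != None].
    apply: (@le_trans _ _ (P [set o | (n%:R * Nz i 0%N <=
      sqnorm (noise_word n (Z i) o))%R] + \sum_(k | xpredT k) P (bad m k))%E).
      apply: le_measure_cover => //.
        by apply: measurable_le_set => //; exact: measurable_sqnorm.
      move=> o; apply: contraPP => /not_orP[/negP nz nb].
      rewrite -ltNge in nz; apply/negP; rewrite negbK; apply/eqP.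
      apply: (@book_decoding_correct R n N K M p cap c X m (Nz i) (acc i)) => //.
        exact: ltW.
      by move=> k bk; apply: nb; exists k.
    rewrite leeD2r// (le_trans thP)// lee_fin lerDr; apply: sumr_ge0 => k _.
    by rewrite /g; case: ifP.
  rewrite negb_forall => /existsP[k]; rewrite negbK => gk.
  apply: (@le_trans _ _ 1%E); first exact: probability_le1.
  rewrite -[leLHS]adde0; apply: leeD; last exact: sume_ge0.
  rewrite lee_fin (bigD1 k)//= {1}/g gk -addrA lerDl addr_ge0//.
  by apply: sumr_ge0 => k' _; rewrite /g; case: ifP.
have msg0 : 0 < #|messages C|%:R :> R.
  rewrite ltr0n; apply/card_gt0P.
  by exists [ffun l => Ordinal (msize_gt0 C l)].
have sumg (k : 'I_N) : \sum_(m : messages C) g (m k) = #|messages C|%:R / M.+1%:R.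
  have := sum_message_marginal (c := C) (l := k) g.
  have -> : \sum_v g v = 2.
    rewrite /g -(@big_enum_val _ _ _ (book_index M) predT
      (fun v => if v.2 == None then 1 else 0))/=.
    rewrite -(pair_bigA _ (fun (b : bool) (o : option 'I_M) =>
      if o == None then 1 else 0 : R))/= big_bool/=.
    by rewrite (bigD1 None)//= big1 ?addr0// => o /negbTE ->.
  have sE : (msize C k)%:R = 2 * M.+1%:R :> R by rewrite /= card_book_index natrM.
  rewrite sE => H.
  have M1 : M.+1%:R != 0 :> R by rewrite pnatr_eq0.
  apply: (@mulIf _ (2 * M.+1%:R)); first by rewrite mulf_neq0 ?pnatr_eq0.
  by rewrite H; field.
rewrite /error_probability ler_pdivrMr//.
rewrite -lee_fin -sumEFin.
apply: (@le_trans _ _ (\sum_(m : messages C)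
    ((\sum_k g (m k) + th)%:E + \sum_k P (bad m k)))%E).
  apply: lee_sum => m _; rewrite fineK; first exact: errP.
  by rewrite fin_num_measure//; exact: merr.
rewrite big_split/= sumEFin exchange_big/= big_split/= exchange_big/=.
rewrite (eq_bigr (fun=> #|messages C|%:R / M.+1%:R)); last by move=> k _; exact: sumg.
rewrite !sumr_const card_ord.
apply: (@le_trans _ _ ((#|messages C|%:R / M.+1%:R *+ N + th *+ #|messages C|)%:E +
    \sum_(k < N) (#|messages C|%:R * (K%:R * eps))%:E)%E).
  rewrite leeD2l//; apply: lee_sum => k _.
  have cE : #|{: 'I_K * book_messages N M}|%:R * eps =
      #|messages C|%:R * (K%:R * eps).
    by rewrite card_prod card_ord natrM (mulrC K%:R) -mulrA.
  rewrite -cE; apply: (le_trans _ (ltW (Xbad k))).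
  rewrite -(pair_bigA _ (fun j m => P [set o | book_bad K p cap c X m (Nz j)
    (acc j) k (noise_word n (Z j) o)]))/= (bigD1 i)//= leeDl//.
  by apply: sume_ge0 => j _; exact: sume_ge0.
rewrite sumEFin -EFinD lee_fin sumr_const card_ord.
have M1 : M.+1%:R != 0 :> R by rewrite pnatr_eq0.
rewrite -(mulr_natr _ N) -(mulr_natr th) -(mulr_natr _ N).
rewrite le_eqVlt; apply/orP; left; apply/eqP; move: (#|messages C|%:R) => z.
by field.
Qed.

(** * Choice of the parameters *)

Lemma layer_power_sum (R : realType) (gamma : R) (l : nat) :
  \sum_(k < l) layer_power gamma k = gamma ^+ l - 1.
Proof.
elim: l => [|l IH]; first by rewrite big_ord0 expr0 subrr.
by rewrite big_ord_recr/= IH /layer_power; ring.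
Qed.

Lemma layer_powerE (R : realType) (gamma : R) (l : nat) :
  layer_power gamma l = gamma ^+ l * (gamma - 1).
Proof. by rewrite /layer_power exprSr; ring. Qed.

Lemma common_ratio (R : realType) (I : finType) (Q : I -> R -> Prop) :
  (forall i x y, 0 <= x -> x <= y -> Q i x -> Q i y) ->
  (forall i, exists x, 0 <= x < 1 /\ Q i x) ->
  exists x, 0 <= x < 1 /\ forall i, Q i x.
Proof.
move=> Qmono /choice[f fP].
exists (\big[Num.max/0]_i f i); split.
  apply/andP; split; first exact: bigmax_ge_id.
  by apply: bigmax_lt => // i _; case: (fP i) => /andP[].
move=> i; have [/andP[fi0 _] Qi] := fP i.
by apply: Qmono Qi => //; exact: le_bigmax.
Qed.

(** Apart from the first receiver, for which sigma^2 = 1, access to [l] unfolds to gamma^(N1 - l) <=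
    Gam i = gamma^N1 / sigma_i^2. *)
Lemma noise_power_le (R : realType) (K : nat) (K_gt0 : (0 < K)%N)
    (Gam sigma : 'I_K -> R) (N1 : nat) (gamma : R) (i : 'I_K) (l : 'I_N1) :
  1 < gamma -> (forall i, 0 < sigma i) -> sigma (Ordinal K_gt0) ^+ 2 = 1 ->
  (forall i, Gam i = Gam (Ordinal K_gt0) / sigma i ^+ 2) ->
  gamma ^+ N1 = Gam (Ordinal K_gt0) ->
  has_access gamma Gam i l -> sigma i ^+ 2 <= gamma ^+ l.
Proof.
move=> gamma1 sigma0 sigma1 GamE gammaN1.
have g0 : 0 < gamma by lra.
have lng : 0 < ln gamma by exact: ln_gt0.
rewrite /has_access /num_subchannels; case: ifP => [/eqP i0|_].
  have -> : i = Ordinal K_gt0 by exact: val_inj.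
  by move=> _; rewrite sigma1 exprn_ege1// ltW.
move=> acc; have s20 : 0 < sigma i ^+ 2 by rewrite exprn_gt0.
have lN := ltnW (ltn_ord l).
have fl : (N1 - l)%:Z <= Num.floor (ln (Gam i) / ln gamma).
  by move: acc; rewrite -subzn//; lia.
move: fl; rewrite floor_ge_int -pmulrn.
rewrite ler_pdivlMr// mulr_natl -lnXn//.
have Gi0 : 0 < Gam i by rewrite GamE -gammaN1 divr_gt0// exprn_gt0.
rewrite ler_ln ?posrE ?exprn_gt0// GamE -gammaN1 ler_pdivlMr//.
rewrite -[in X in _ <= X](subnK lN) exprD ler_pM2l// exprn_gt0//.
Qed.

(** [rho] is a rate in nats, the midpoint between r ln 2 and the capacity. The positive part in
    [capacity_hat] disappears because r >= 0. *)
Lemma capacity_hat_gap (R : realType) (gamma mu r : R) :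
  1 < gamma -> 0 <= mu -> 0 <= r -> r < capacity_hat (gamma / (1 + mu)) ->
  exists rho, [/\ 0 < rho, r * ln 2 <= rho & expR (2 * rho) * (1 + mu) < gamma].
Proof.
move=> gamma1 mu0 r0; rewrite /capacity_hat lt_max ltNge r0/=.
rewrite /capacity /log2 addrC subrK => H.
have l2 : 0 < ln 2 :> R by rewrite ln_gt0// ltr1n.
have x0 : 0 < gamma / (1 + mu) by rewrite divr_gt0//; lra.
have {}H : r * ln 2 < 2^-1 * ln (gamma / (1 + mu)).
  by rewrite -ltr_pdivlMr// -mulrA.
have rl0 : 0 <= r * ln 2 by rewrite mulr_ge0// ltW.
set y := ln (gamma / (1 + mu)) in H *.
exists ((r * ln 2 + 2^-1 * y) / 2); split; [lra|lra|].
rewrite -ltr_pdivlMr; last lra.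
rewrite -[ltRHS]lnK ?posrE// ltr_expR; move: (H); rewrite /y; lra.
Qed.

Lemma sgn_gauss_word (R : realType) (d : measure_display)
    (Omega : measurableType d) (P : probability Omega R) (n : nat) (a : R)
    (Z : nat -> {RV P >-> R}) (b : bool) (o : Omega) :
  sgn_signal b (gauss_word n a Z o) = gauss_word n ((-1) ^+ b * a) Z o.
Proof. by apply: eq_from_tnth => t; rewrite !tnth_mktuple mulrA. Qed.

(** The three deviations of a word of power [q] from its mean: [cap] and [p] lie above [q] and [c]
    below. One ratio [x] holds for all interference vectors and block lengths. *)
Lemma layer_ratio (R : realType) (d : measure_display)
    (Omega : measurableType d) (P : probability Omega R)
    (Z : nat -> {RV P >-> R}) (sigma a q c cap p Nm : R) :
  0 < sigma -> iid_normal sigma Z -> (a * sigma) ^+ 2 = q ->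
  0 <= c -> c < q -> q < cap -> q < p -> 0 <= Nm ->
  exists x, 0 <= x < 1 /\ forall n,
  (P [set o | (n%:R * cap <= sqnorm (gauss_word n a Z o))%R] <= (x ^+ n)%:E)%E /\
  forall b (u : signal n R), sqnorm u <= n%:R * Nm ->
  (P [set o | (sqnorm u + n%:R * p <=
     sqnorm (add_signal (sgn_signal b (gauss_word n a Z o)) u))%R] <= (x ^+ n)%:E)%E /\
  (P [set o | (sqnorm (add_signal (sgn_signal b (gauss_word n a Z o)) u) <=
     sqnorm u + n%:R * c)%R] <= (x ^+ n)%:E)%E.
Proof.
move=> sigma0 iidZ aq c0 cq qcap qp Nm0.
have q0 : 0 < q by apply: le_lt_trans cq.
have [x1 [/andP[x10 x11] H1]] := @deviation_bound _ q cap Nm q0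
  (ltW (lt_trans q0 qcap)) Nm0 (negbT (gt_eqF qcap)).
have [x2 [/andP[x20 x21] H2]] := @deviation_bound _ q p Nm q0
  (ltW (lt_trans q0 qp)) Nm0 (negbT (gt_eqF qp)).
have [x3 [/andP[x30 x31] H3]] := @deviation_bound _ q c Nm q0
  c0 Nm0 (negbT (lt_eqF cq)).
have aqb b : ((-1) ^+ b * a * sigma) ^+ 2 = q.
  by rewrite -mulrA exprMn sqrr_sign mul1r.
pose x := Num.max x1 (Num.max x2 x3).
have le1 : x1 <= x by rewrite /x !le_max lexx.
have le2 : x2 <= x by rewrite /x !le_max lexx orbT.
have le3 : x3 <= x by rewrite /x !le_max lexx !orbT.
have x0 : 0 <= x by apply: le_trans le1.
have mono y n : 0 <= y -> y <= x -> ((y ^+ n)%:E <= (x ^+ n)%:E)%E.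
  by move=> y0 yx; rewrite lee_fin lerXn2r// nnegrE.
exists x; split; first by rewrite x0 !gt_max x11 x21.
move=> n; split.
  apply: le_trans (mono _ n x10 le1).
  (* The length of the codeword itself is the case of zero interference. *)
  have := H1 _ _ P Z sigma a n zero_signal sigma0 iidZ aq.
  rewrite sqnorm_zero => /(_ (mulr_ge0 (ler0n _ _) Nm0)).
  congr (P _ <= _)%E; apply: eq_set => o.
  rewrite pmulr_rge0 ?subr_gt0// subr0 subr_ge0.
  by congr (is_true (_ <= sqnorm _)); apply: eq_from_tnth => t; rewrite !tnth_mktuple addr0.
move=> b u uN; split.
  apply: le_trans (mono _ n x20 le2).
  have := H2 _ _ P Z sigma ((-1) ^+ b * a) n u sigma0 iidZ (aqb b) uN.
  congr (P _ <= _)%E; apply: eq_set => o.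
  by rewrite pmulr_rge0 ?subr_gt0// sgn_gauss_word subr_ge0 lerBrDl.
apply: le_trans (mono _ n x30 le3).
have := H3 _ _ P Z sigma ((-1) ^+ b * a) n u sigma0 iidZ (aqb b) uN.
congr (P _ <= _)%E; apply: eq_set => o.
by rewrite nmulr_rge0 ?subr_lt0// sgn_gauss_word subr_le0 lerBlDl.
Qed.

Lemma sgn_pairwise_error_bound (R : realType) (d : measure_display)
    (Omega : measurableType d) (P : probability Omega R)
    (Z : nat -> {RV P >-> R}) (sigma a c N x : R) (n : nat) (b : bool)
    (y u : signal n R) :
  0 < sigma -> iid_normal sigma Z -> 0 <= c -> 0 < N -> 0 < x ->
  x <= 1 + c / N -> sqnorm u <= n%:R * N -> sqnorm u + n%:R * c <= sqnorm y ->
  (P [set o | (sqnorm (sub_signal y (sgn_signal b (gauss_word n a Z o))) <=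
       sqnorm u)%R] <= ((Num.sqrt x)^-1 ^+ n)%:E)%E.
Proof.
move=> sigma0 iidZ c0 N0 x0 xN uN uy.
have := @pairwise_error_bound _ _ _ P Z sigma ((-1) ^+ b * a) c N (sqnorm u) n y
  sigma0 iidZ c0 N0 uN uy.
move=> /le_trans H; under eq_set do rewrite sgn_gauss_word.
apply: H; rewrite lee_fin lerXn2r// ?nnegrE ?invr_ge0 ?sqrtr_ge0//.
have sx : 0 < Num.sqrt x by rewrite sqrtr_gt0.
by rewrite lef_pV2 ?posrE ?ler_sqrt// ?sqrtr_gt0; lra.
Qed.

Lemma noise_ratio (R : realType) (d : measure_display)
    (Omega : measurableType d) (P : probability Omega R)
    (Z : nat -> {RV P >-> R}) (sigma N : R) :
  0 < sigma -> iid_normal sigma Z -> sigma ^+ 2 < N ->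
  exists x, 0 <= x < 1 /\ forall n,
  (P [set o | (n%:R * N <= sqnorm (noise_word n Z o))%R] <= (x ^+ n)%:E)%E.
Proof.
move=> sigma0 iidZ sN; have s20 : 0 < sigma ^+ 2 by rewrite exprn_gt0.
have [x [x01 H]] := @deviation_bound _ (sigma ^+ 2) N 0 s20
  (ltW (lt_trans s20 sN)) (lexx _) (negbT (gt_eqF sN)).
exists x; split=> // n; rewrite noise_wordE.
have := H _ _ P Z sigma 1 n zero_signal sigma0 iidZ.
rewrite mul1r sqnorm_zero mulr0 lexx => /(_ erefl isT).
congr (P _ <= _)%E; apply: eq_set => o.
rewrite pmulr_rge0 ?subr_gt0// subr0 subr_ge0.
by congr (is_true (_ <= sqnorm _)); apply: eq_from_tnth => t; rewrite !tnth_mktuple addr0.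
Qed.

Theorem lemma3 (R : realType) (K : nat) (K_gt0 : (0 < K)%N)
    (Gam sigma : 'I_K -> R)
    (d : measure_display) (Omega : measurableType d) (P : probability Omega R)
    (Z : 'I_K -> nat -> {RV P >-> R})
    (Gam_noninc : forall i j : 'I_K, (i <= j)%N -> Gam j <= Gam i)
    (Gam1_gt1 : 1 < Gam (Ordinal K_gt0))
    (sigma_gt0 : forall i, 0 < sigma i)
    (sigma1 : sigma (Ordinal K_gt0) ^+ 2 = 1)
    (GamE : forall i, Gam i = Gam (Ordinal K_gt0) / sigma i ^+ 2)
    (Z_iid : forall i, iid_normal (sigma i) (Z i))
    (N1 : nat) (N1_gt0 : (0 < N1)%N)
    (gamma : R) (gamma_gt1 : 1 < gamma)
    (gammaN1 : gamma ^+ N1 = Gam (Ordinal K_gt0))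
    (mu : R) (muE : mu = if K == 1%N then 0 else 1)
    (r : R) (r_ge0 : 0 <= r) (r_lt : r < capacity_hat (gamma / (1 + mu))) :
  exists c : forall n : nat, layered_code R n N1 K,
    (forall n : nat, (0 < n)%N ->
      [/\ forall l, average_power (@enc _ _ _ _ (c n) l) = layer_power gamma l,
          average_power (transmitted (c := c n)) <= Gam (Ordinal K_gt0),
          forall l, r <= code_rate (c n) l
        & forall i l, has_access gamma Gam i l ->
            treats_lower_as_noise (c n) (sigma i) (layer_power gamma) i l]) /\
    (forall i l, has_access gamma Gam i l ->
      error_probability (c n) (Z i) i l @[n --> \oo] --> (0 : R)).
Proof.
set o0 := Ordinal K_gt0 in Gam1_gt1 sigma1 GamE gammaN1 *.
have mu0 : 0 <= mu by rewrite muE; case: ifP.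
have [rho [rho0 rrho Egam]] := capacity_hat_gap gamma_gt1 mu0 r_ge0 r_lt.
set E := expR (2 * rho) in Egam.
have E1 : 1 < E by rewrite expR_gt1 mulr_gt0.
pose p := layer_power gamma.
have gk1 k : 1 <= gamma ^+ k by rewrite exprn_ege1// ltW.
have pE k : p k = gamma ^+ k * (gamma - 1) by exact: layer_powerE.
have p0 k : 0 < p k by rewrite pE mulr_gt0 ?subr_gt0// (lt_le_trans ltr01).
(* [kap] is the fraction of the layer power that would just give 1 + SNR = E against interference (1
   + mu) gamma^l. [dl] is a quarter of the slack 1 - kap, shared among all the margins below. *)
pose kap := (1 + mu) * (E - 1) / (gamma - 1).
have kap0 : 0 < kap by rewrite /kap divr_gt0 ?mulr_gt0 ?subr_gt0//; lra.
have kap1 : kap < 1 by rewrite /kap ltr_pdivrMr ?subr_gt0//; lra.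
have kapE : kap * (gamma - 1) = (1 + mu) * (E - 1).
  by rewrite /kap divfK// subr_eq0 gt_eqF.
pose dl := (1 - kap) / 4.
have dlE : kap = 1 - 4 * dl by rewrite /dl; field.
have dl0 : 0 < dl by rewrite /dl; lra.
have dl1 : dl < 1 / 4 by rewrite /dl; lra.
pose c k := (1 - dl) * p k; pose q k := (1 - dl / 2) * p k.
pose cap k := (1 - dl / 4) * p k.
have cq k : [/\ 0 <= c k, c k < q k, q k < cap k & cap k < p k].
  have pk := p0 k; rewrite /c /q /cap; split; nra.
(* The lower layers contribute gamma^k - 1; the final [dl] leaves room for fluctuations of the
   noise. *)
pose Nz (i : 'I_K) k := gamma ^+ k - 1 + sigma i ^+ 2 + dl.
have s20 i : 0 < sigma i ^+ 2 by rewrite exprn_gt0.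
have Nz0 i k : 0 < Nz i k.
  by have := gk1 k; have := s20 i; rewrite /Nz; lra.
have NzS i k : Nz i k.+1 = Nz i k + p k by rewrite /Nz pE exprSr; ring.
pose Nm := \sum_i Nz i N1.
have NzNm i k : (k <= N1)%N -> Nz i k <= Nm.
  move=> kN; apply: (@le_trans _ _ (Nz i N1)).
    by rewrite /Nz !lerD2r ler_eXn2l.
  by rewrite /Nm (bigD1 i)//= lerDl sumr_ge0// => j _; exact: ltW.
have Nm0 : 0 < Nm by apply: lt_le_trans (NzNm o0 _ (leqnn N1)).
pose acc (i : 'I_K) (l : 'I_N1) := has_access gamma Gam i l.
have acc_up i (l k : 'I_N1) : acc i l -> (l <= k)%N -> acc i k.
  by rewrite /acc /has_access => il lk; rewrite (le_trans il)// lez_nat ltnS.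
(* A lower bound for 1 + c / N on every accessible layer, where c = (1 - dl) (gamma - 1) gamma^l and
   N <= (1 + mu) (1 + dl) gamma^l. It exceeds [E] because (1 - 4 dl) (1 + dl) < 1 - dl. *)
pose chi := 1 + (1 - dl) * (gamma - 1) / ((1 + mu) * (1 + dl)).
have m1 : 0 < (1 + mu) * (1 + dl) by rewrite mulr_gt0//; lra.
have chiE : E < chi.
  rewrite /chi -ltrBlDl ltr_pdivlMr//.
  have -> : (E - 1) * ((1 + mu) * (1 + dl)) = kap * (gamma - 1) * (1 + dl).
    by rewrite kapE; ring.
  have : 0 < gamma - 1 by rewrite subr_gt0.
  by rewrite dlE => g1; nra.
have chi0 : 0 < chi by lra.
have accN i l : acc i l -> chi <= 1 + c l / Nz i l.
  move=> il; have G1 := gk1 l; set G := gamma ^+ l in G1.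
  have sG : sigma i ^+ 2 <= G.
    exact: (noise_power_le gamma_gt1 sigma_gt0 sigma1 GamE gammaN1 il).
  have NG : Nz i l <= (1 + mu) * (1 + dl) * G.
    rewrite /Nz -/G muE; case: eqP => K1; last by nra.
    have -> : i = o0.
      apply/val_inj/eqP; rewrite /= -leqn0 -ltnS.
      by apply: (leq_trans (ltn_ord i)); rewrite K1.
    by rewrite sigma1; nra.
  rewrite /chi lerD2l ler_pdivrMr// mulrAC ler_pdivlMr// /c pE -/G.
  have : 0 <= (1 - dl) * (gamma - 1) by rewrite mulr_ge0//; lra.
  by set z := _ * (gamma - 1) => z0; have := ler_wpM2l z0 NG; rewrite /z; lra.
have sq k : 0 <= q k by have [? ? _ _] := cq k; lra.
have aq k : (Num.sqrt (q k) / sigma o0 * sigma o0) ^+ 2 = q k.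
  by rewrite divfK ?gt_eqF// sqr_sqrtr.
have [||x1 [/andP[x10 x11] Hx1]] := common_ratio (I := 'I_N1)
  (Q := fun l x => forall n,
    (P [set o | (n%:R * cap l <= sqnorm (gauss_word n (Num.sqrt (q l) / sigma o0) (Z o0) o))%R]
      <= (x ^+ n)%:E)%E /\
    forall b (u : signal n R), sqnorm u <= n%:R * Nm ->
    (P [set o | (sqnorm u + n%:R * p l <= sqnorm (add_signal (sgn_signal b
       (gauss_word n (Num.sqrt (q l) / sigma o0) (Z o0) o)) u))%R] <= (x ^+ n)%:E)%E /\
    (P [set o | (sqnorm (add_signal (sgn_signal b
       (gauss_word n (Num.sqrt (q l) / sigma o0) (Z o0) o)) u) <=
       sqnorm u + n%:R * c l)%R] <= (x ^+ n)%:E)%E).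
- move=> l x y x0 xy H n; have [H1 H2] := H n.
  have xyn : ((x ^+ n)%:E <= (y ^+ n)%:E)%E.
    by rewrite lee_fin lerXn2r// nnegrE// (le_trans x0).
  split=> [|b u uN]; first exact: le_trans H1 xyn.
  by have [H3 H4] := H2 b u uN; split; [exact: le_trans H3 xyn|exact: le_trans H4 xyn].
- move=> l; have [c0 cql qcap capp] := cq l.
  exact: (layer_ratio (sigma_gt0 o0) (Z_iid o0) (aq l) c0 cql qcap
    (lt_trans qcap capp) (ltW Nm0)).
have [||x2 [/andP[x20 x21] Hx2]] := common_ratio (I := 'I_K)
  (Q := fun i x => forall n,
    (P [set o | (n%:R * Nz i 0%N <= sqnorm (noise_word n (Z i) o))%R] <= (x ^+ n)%:E)%E).
- move=> i x y x0 xy H n; apply: le_trans (H n) _.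
  by rewrite lee_fin lerXn2r// nnegrE// (le_trans x0).
- move=> i; apply: noise_ratio (sigma_gt0 i) (Z_iid i) _.
  by rewrite /Nz expr0 subrr add0r ltrDl.
(* Growth rate of the number of rivals times decay rate of the pairwise error; it is below 1 exactly
   because E < chi. *)
pose eta := expR rho / Num.sqrt chi.
have sqchi0 : 0 < Num.sqrt chi by rewrite sqrtr_gt0.
have eta0 : 0 <= eta by rewrite divr_ge0 ?expR_ge0// ltW.
have eta1 : eta < 1.
  rewrite ltr_pdivrMr// mul1r -ltr_sqr ?nnegrE ?expR_ge0 ?sqrtr_ge0//.
  by rewrite sqr_sqrtr ?(ltW chi0)// -expRM_natl.
pose M n := (Num.truncn (expR (n%:R * rho))).+1.
have Mge n : expR (n%:R * rho) <= (M n)%:R by apply: ltW; exact: truncnS_gt.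
have Mle n : (M n)%:R <= 2 * expR (n%:R * rho).
  have h1 : 1 <= expR (n%:R * rho) by rewrite -expR0 ler_expR mulr_ge0// ltW.
  have h2 : (Num.truncn (expR (n%:R * rho)))%:R <= expR (n%:R * rho).
    by rewrite truncn_le expR_ge0.
  rewrite /M -addn1 natrD; lra.
(* The 4 is 2 for the signs of a rival times 2 from M <= 2 e^(n rho); the last term only makes the
   inequality strict. *)
pose eps n : R := 3 * x1 ^+ n + 4 * eta ^+ n + n.+1%:R^-1.
have epsP n : 3 * x1 ^+ n + (M n)%:R * (2 * (Num.sqrt chi)^-1 ^+ n) < eps n.
  apply: (@le_lt_trans _ _ (3 * x1 ^+ n + 4 * eta ^+ n)); last first.
    by rewrite /eps ltrDl invr_gt0.
  rewrite lerD2l /eta exprMn -expRM_natl.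
  have : 0 <= (Num.sqrt chi)^-1 ^+ n by rewrite exprn_ge0// invr_ge0 ltW.
  by move: (Mle n) => Mn s0; have := ler_wpM2r s0 Mn; lra.
pose bound n : R := N1%:R * expR (- rho) ^+ n + x2 ^+ n + N1%:R * (K%:R * eps n).
(* The value of [M] beyond which the [None] words are far enough, since p - cap = dl p / 4 >= dl
   (gamma - 1) / 4. It is exceeded from [n0] on, as e^(n rho) >= 1 + n rho. Below [n0] the power,
   rate and likelihood requirements still hold. *)
pose B0 := 16 * Nm / (dl * (gamma - 1)).
pose n0 := (Num.truncn (B0 / rho)).+1.
have Mbig n (i : 'I_K) (k : 'I_N1) : (n0 <= n)%N ->
    4 * (Nz i k + p k) < (M n)%:R * (p k - cap k).
  move=> nn; have B0M : B0 < (M n)%:R.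
    apply: lt_le_trans (Mge n); apply: (@lt_le_trans _ _ (1 + n%:R * rho)).
      rewrite ltr_pwDl// -ler_pdivrMr//.
      apply: (@le_trans _ _ n0%:R); first by apply: ltW; exact: truncnS_gt.
      by rewrite ler_nat.
    exact: expR_ge1Dx.
  rewrite -NzS; apply: (@le_lt_trans _ _ (4 * Nm)).
    by rewrite ler_pM2l//; exact: NzNm.
  have g1 : 0 < gamma - 1 by rewrite subr_gt0.
  have dg : 0 < dl * (gamma - 1) by rewrite mulr_gt0.
  move: B0M; rewrite /B0 ltr_pdivrMr// => B0M.
  have MR : 0 < (M n)%:R :> R by rewrite ltr0n.
  have pg : gamma - 1 <= p k by rewrite pE ler_peMl// ltW.
  have pk : p k - cap k = dl * p k / 4 by rewrite /cap; field.
  have : (M n)%:R * (dl * (gamma - 1)) <= (M n)%:R * (dl * p k).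
    by rewrite ler_pM2l// ler_pM2l.
  by rewrite pk; lra.
have : forall n, exists code : layered_code R n N1 K, (0 < n)%N ->
    [/\ [/\ forall l, average_power (@enc _ _ _ _ code l) = layer_power gamma l,
          average_power (transmitted (c := code)) <= Gam o0,
          forall l, r <= code_rate code l
        & forall i l, has_access gamma Gam i l ->
            treats_lower_as_noise code (sigma i) (layer_power gamma) i l] &
    (n0 <= n)%N -> forall i l, acc i l ->
      error_probability code (Z i) i l <= bound n].
  move=> n.
  have [n_eq0|n_gt0] := posnP n.
    (* Any code will do at block length 0, where nothing is claimed. *)
    by exists (book_code 1 p cap (fun _ _ => zero_signal)); rewrite [X in (_ < X)%N]n_eq0.
  have cap_ok (k : 'I_N1) : [/\ 0 <= c k, 0 <= cap k & cap k < p k].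
    by have [h1 h2 h3 h4] := cq k; split=> //; lra.
  have [||//|X HX] := @choose_books R d Omega P n N1 K (M n) Z p cap c Nz acc (eps n).
  - by [].
  - move=> l F w idx sg rc F0 mw idxM.
    apply: (@layer_codebook R d Omega P n (M n) F
      (gauss_word n (Num.sqrt (q l) / sigma o0) (Z o0)) w idx sg
      (fun e => acc (rc e) l) (fun e => Nz (rc e) l) (c l) (cap l) (p l)
      (x1 ^+ n) ((Num.sqrt chi)^-1 ^+ n)) => //.
    + exact: measurable_gauss_word.
    + exact: (Hx1 l n).1.
    + move=> e b u uN; apply: ((Hx1 l n).2 b u _).1.
      by rewrite (le_trans uN)// ler_wpM2l// NzNm// ltnW.
    + move=> e b u uN; apply: ((Hx1 l n).2 b u _).2.
      by rewrite (le_trans uN)// ler_wpM2l// NzNm// ltnW.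
    + move=> e b y u al uN uy; have [c0 _ _] := cap_ok l.
      exact: (sgn_pairwise_error_bound _ b (sigma_gt0 o0) (Z_iid o0) c0
        (Nz0 _ _) chi0 (accN _ _ al) uN uy).
    + by rewrite ltr_pM2l ?ltr0n.
  exists (book_code (M n) p cap X) => _; split; last first.
    move=> nn i l il.
    apply: (@le_trans _ _ (N1%:R / (M n).+1%:R + x2 ^+ n + N1%:R * (K%:R * eps n))).
      apply: (@book_error_bound _ _ _ _ n N1 K (M n) Z p cap c Nz acc) => //.
      + by move=> k; rewrite NzS.
      + by move=> k; exact: Mbig.
      + by move=> k lk; exact: acc_up il lk.
    rewrite /bound !lerD2r ler_wpM2l// -expRM_natl mulrN expRN.
    rewrite lef_pV2 ?posrE ?expR_gt0//.
    by rewrite (le_trans (Mge n))// ler_nat.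
  have Mgt0 : 0 < #|book_index (M n)|%:R :> R by rewrite card_book_index ltr0n.
  split.
  - by move=> l; have [_ h1 h2] := cap_ok l; exact: book_average_power h1 (ltW h2).
  - rewrite book_transmitted_power//; first 1 last.
    + by move=> l; have [] := cap_ok l.
    + by move=> l; have [_ _ /ltW] := cap_ok l.
    (* The layer powers telescope to gamma^N1 - 1, one unit below the allowed power. *)
    by rewrite layer_power_sum gammaN1 lerBlDr lerDl.
  - move=> l; rewrite /code_rate /log2 /=.
    rewrite ler_pdivlMr ?ltr0n// ler_pdivlMr ?ln_gt0 ?ltr1n//.
    rewrite -ler_expR lnK ?posrE//.
    apply: (@le_trans _ _ (expR (n%:R * rho))).
      by rewrite ler_expR mulrAC mulrC ler_wpM2l.
    apply: (le_trans (Mge n)); rewrite card_book_index ler_nat.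
    by rewrite (leq_trans (leqnSn _))// leq_pmull.
  - move=> i l il v y m; apply: nearest_maximizes_likelihood; last exact: nn_decoderP.
    by rewrite ltr_pwDl// layer_power_sum subr_ge0.
move=> H; pose code n := projT1 (cid (H n)).
have codeP n := projT2 (cid (H n)).
exists code; split; first by move=> n n_gt0; have [] := codeP n n_gt0.
move=> i l il; apply: (@squeeze_cvgr _ _ _ _ (fun=> 0) bound).
- near=> n; have n_gt0 : (0 < n)%N by near: n; exact: nbhs_infty_gt.
  have nn0 : (n0 <= n)%N by near: n; exact: nbhs_infty_ge.
  have [_ /(_ nn0 i l il) ->] := codeP n n_gt0; rewrite andbT.
  by rewrite divr_ge0// sumr_ge0// => m _; rewrite fine_ge0.
- exact: cvg_cst.
- have cexp x : 0 <= x -> x < 1 -> (fun n => x ^+ n : R) @ \oo --> (0 : R).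
    by move=> h0 h1; apply: cvg_expr; rewrite ger0_norm.
  have r1 : expR (- rho) < 1 by rewrite -expR0 ltr_expR oppr_lt0.
  have ceps : eps n @[n --> \oo] --> (0 : R).
    rewrite -(addr0 0) -{1}(addr0 0) -{1}(mulr0 3) -{2}(mulr0 4).
    apply: cvgD; last exact: cvg_harmonic.
    apply: cvgD; apply: cvgMr; exact: cexp.
  have -> : (0 : R) = N1%:R * 0 + 0 + N1%:R * (K%:R * 0) by rewrite !mulr0 !addr0.
  apply: cvgD; last by apply: cvgMr; exact: cvgMr.
  apply: cvgD; last exact: cexp.
  by apply: cvgMr; apply: cexp => //; exact: expR_ge0.
Unshelve. all: by end_near.
Qed.
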